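(* Let $\Gamma=\Gamma_p$ for some $1<p\leq 2$, and let $f$ satisfy: (1) $f\in C^1(\Gamma)\cap C^0(\bar{\Gamma})$ is symmetric, i.e. $f(\lambda_1,\lambda_2)=f(\lambda_2,\lambda_1)$; (2) $f$ is homogeneous of degree $1$; (3) $f>0$ and $f_{\lambda_i}:=\frac{\partial f}{\partial\lambda_i}>0$ in $\Gamma$ for $i=1,2$, and $f|_{\partial\Gamma}=0$; (4) $f$ is concave in $\Gamma$. Let $K$ be a $C^2$ positive function in $B_r\subset\mathbb{R}^2$, and let $u\in C^4(B_r)$ satisfy $$f(\lambda(A^u))=K,\quad \lambda(A^u)\in\Gamma\quad\text{in }B_r.$$ Then $$|\nabla^2 u|\leq C\quad\text{in }B_{r/2},$$ for some constant $C$ depending only on $r$, $(f,\Gamma)$, and upper bounds of $\sup_{B_r}u$ and $\|K\|_{C^2(B_r)}$.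
   Context: $B_r$ is the open ball of radius $r>0$ centered at the origin in $\mathbb{R}^2$. For $1\le p\le 2$, $\Gamma_p:=\{(\lambda_1,\lambda_2)\in\mathbb{R}^2:\lambda_2>(p-2)\lambda_1,\ \lambda_1>(p-2)\lambda_2\}$. For a $C^2$ function $u$, $$A^u=-\frac{\nabla^2u}{e^u}+\frac{1}{2}\frac{du\otimes du}{e^u}-\frac{1}{4}\frac{|\nabla u|^2}{e^u}I,$$ and $\lambda(A^u)$ denotes the eigenvalues of the symmetric matrix $A^u$. *)

(* Defs.v *)
From HB Require Import structures.
From mathcomp Require Import all_boot all_order all_algebra.
From mathcomp Require Import all_classical all_reals all_analysis.
Import Order.TTheory GRing.Theory Num.Theory.
Import numFieldNormedType.Exports.

Set Implicit Arguments.
Unset Strict Implicit.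
Unset Printing Implicit Defensive.

Local Open Scope classical_set_scope.
Local Open Scope ring_scope.

(* Points of R^2 are row vectors.  The library norm on matrices is the sup
   norm, hence the Euclidean (Frobenius) norm below; both induce the same
   topology and the same derivatives. *)
Definition enorm (R : realType) (m n : nat) (A : 'M[R]_(m, n)) : R :=
  Num.sqrt (\sum_(i < m) \sum_(j < n) A i j ^+ 2).

Definition eball (R : realType) (r : R) : set 'rV[R]_2 :=
  [set x | enorm x < r].

Definition boundary (T : topologicalType) (A : set T) : set T :=
  closure A `\` interior A.

Definition partial (R : realType) (i : 'I_2) (g : 'rV[R]_2 -> R)
    (x : 'rV[R]_2) : R :=
  'D_(delta_mx 0 i) g x.

(* g is of class C^k on U; meant for U open, g being arbitrary outside U. *)
Fixpoint Ck (R : realType) (k : nat) (U : set 'rV[R]_2) (g : 'rV[R]_2 -> R)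
    : Prop :=
  (forall x, U x -> {for x, continuous g}) /\
  match k with
  | 0%N => True
  | k'.+1 => forall i : 'I_2,
      (forall x, U x -> derivable g x (delta_mx 0 i)) /\ Ck k' U (partial i g)
  end.

Definition gradient (R : realType) (g : 'rV[R]_2 -> R) (x : 'rV[R]_2)
    : 'rV[R]_2 :=
  \row_(i < 2) partial i g x.

Definition hessian (R : realType) (g : 'rV[R]_2 -> R) (x : 'rV[R]_2)
    : 'M[R]_2 :=
  \matrix_(i < 2, j < 2) partial j (partial i g) x.

Definition Amx (R : realType) (u : 'rV[R]_2 -> R) (x : 'rV[R]_2) : 'M[R]_2 :=
  - ((expR (u x))^-1 *: hessian u x)
  + (2^-1 * (expR (u x))^-1) *: ((gradient u x)^T *m gradient u x)
  - (4^-1 * (enorm (gradient u x) ^+ 2 * (expR (u x))^-1))%:M.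

(* l lists the eigenvalues of A, repeated according to multiplicity. *)
Definition eigenvalues (R : realType) (A : 'M[R]_2) (l : 'rV[R]_2) : Prop :=
  char_poly A = \prod_(i < 2) ('X - (l 0 i)%:P).

Definition Gamma (R : realType) (p : R) : set 'rV[R]_2 :=
  [set l | (p - 2) * l 0 0 < l 0 1 /\ (p - 2) * l 0 1 < l 0 0].

Definition swap (R : realType) (l : 'rV[R]_2) : 'rV[R]_2 :=
  \row_(i < 2) l 0 (rev_ord i).

Record admissible (R : realType) (G : set 'rV[R]_2) (f : 'rV[R]_2 -> R)
    : Prop := Admissible {
  adm_C1 : Ck 1 G f;
  adm_C0 : {within closure G, continuous f};
  adm_sym : forall l, closure G l -> f (swap l) = f l;
  adm_homog : forall (t : R) l, 0 < t -> closure G l -> f (t *: l) = t * f l;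
  adm_pos : forall l, G l -> 0 < f l;
  adm_partial_pos : forall l, G l -> forall i : 'I_2, 0 < partial i f l;
  adm_boundary : forall l, boundary G l -> f l = 0;
  adm_concave : forall (t : R) l m, 0 <= t -> t <= 1 -> G l -> G m ->
    t * f l + (1 - t) * f m <= f (t *: l + (1 - t) *: m)
}.

Definition sup_on (R : realType) (U : set 'rV[R]_2) (g : 'rV[R]_2 -> R)
    : \bar R :=
  ereal_sup [set (g x)%:E | x in U].

(* Possibly +oo, as g is not assumed bounded up to the boundary of U. *)
Definition C2norm (R : realType) (U : set 'rV[R]_2) (g : 'rV[R]_2 -> R)
    : \bar R :=
  (sup_on U (fun x => `|g x|%R) + sup_on U (fun x => enorm (gradient g x))
   + sup_on U (fun x => enorm (hessian g x)))%E.

(* Main.v *)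
Require Import Defs.
From HB Require Import structures.
From mathcomp Require Import all_boot all_order all_algebra.
From mathcomp Require Import all_classical all_reals all_analysis.
From mathcomp Require Import ring lra.
Import Order.TTheory GRing.Theory Num.Theory.
Import numFieldNormedType.Exports.

(** Multiplied by e^u, the equation reads f(lambda(W)) = K e^u for
    W = - D^2 u + (1/2) du du^T - (1/4) |du|^2 I, and in dimension two the
    trace of W is H = - Lap u > 0.  The estimate is a Bernstein argument for
    the single function Q = 2 H + |du|^2, which controls the gradient and the
    Hessian together.  It rests on three facts.

    Linearisation.  As f is concave and homogeneous of degree one, its gradient
    (a, b) at l satisfies f m <= a m_1 + b m_2 on the cone, with equality at
    m = l ([support_vector], [euler_identity]).  Let F be the constant
    symmetric matrix with eigenvalues a, b in an eigenframe of W(x0).  Then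
    tr (F W) - K e^u is nonnegative and vanishes at x0 ([frame_support]), so
    its first derivatives vanish there and its second derivatives in any
    direction are nonnegative.  This replaces differentiating the equation
    twice, and works although f is only C^1.

    Cancellation.  Put L = F_ij d_ij - F_ij u_i d_j + (a + b)/2 u_i d_i.  The
    previous step bounds L H and computes L |du|^2; both contain the term
    H tr (F M0), where M0 is the trace-free part of M = D^2 u, because
    M^2 - (1/2) |M|^2 I = (tr M) M0 for two by two matrices.  It drops out of
    exactly one combination ([bernstein_identity]):
    L Q >= (a + b) |M|^2 + 2 e^u (Lap K + dK.du - K H).

    Pinching.  For p > 1 the eigenvalues of a matrix in the cone differ by at
    most a multiple of its trace.  If M were small compared with |du|^2, then
    W would be close to the trace-free matrix (1/2) du du^T - (1/4) |du|^2 I,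
    which has eigenvalues |du|^2/4 and - |du|^2/4 and lies outside the cone.
    Hence |M|^2 >= c Q^2 ([hessian_dominates]).

    So L Q >= c (a + b) Q^2 - C (1 + Q), while a + b >= f (1, 1) > 0, and the
    maximum principle applied to (s^2 - |x|^2)^2 Q on a ball of radius s < r
    bounds Q ([bernstein_cutoff_max]).  Pinching once more bounds |M| by Q.
    The solution enters the constants only through e^u <= e^M, and K only
    through upper bounds. *)

Local Open Scope classical_set_scope.
Local Open Scope ring_scope.

Set Implicit Arguments.
Unset Strict Implicit.
Unset Printing Implicit Defensive.

(** * Directional derivatives in the plane *)

Lemma is_derive_line (R : realType) (g : 'rV[R]_2 -> R) (x v : 'rV[R]_2)
    (t d : R) :
  is_derive (x + t *: v) v g d -> is_derive t 1 (fun s => g (x + s *: v)) d.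
Proof.
have E : (fun h : R => h^-1 *: (g (x + (h *: 1 + t) *: v) - g (x + t *: v))) =
         (fun h : R => h^-1 *: (g (h *: v + (x + t *: v)) - g (x + t *: v))).
  apply/funext => h; congr (_ *: (g _ - _)).
  by rewrite [h *: 1]mulr1 scalerDl addrCA.
move=> [dg Dg]; split.
  by rewrite /derivable /= E.
by rewrite -Dg /derive /= E.
Qed.

(** The mean value theorem with an increment of either sign, so that the path
    arguments below need not distinguish cases. *)
Lemma mean_value_signed (R : realType) (g dg : R -> R) (h : R) :
  (forall t : R, `|t| <= `|h| -> is_derive t 1 g (dg t)) ->
  exists2 c, `|c| <= `|h| & g h - g 0 = h * dg c.
Proof.
move=> dgP.
have cont t : `|t| <= `|h| -> {for t, continuous g}.
  move=> th; apply: differentiable_continuous; apply/derivable1_diffP.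
  by have [] := dgP _ th.
have [h0|h0] := leP 0 h.
- have [||c] := @MVT_segment R g dg 0 h h0.
  + move=> t; rewrite in_itv /= => /andP[t0 th]; apply: dgP.
    by rewrite !ger0_norm// ltW.
  + apply: continuous_in_subspaceT => t; rewrite inE /= in_itv /= => /andP[t0 th].
    by apply: cont; rewrite !ger0_norm.
  rewrite in_itv /= => /andP[c0 ch] E; exists c; first by rewrite !ger0_norm.
  by rewrite E subr0 mulrC.
- have [||c] := @MVT_segment R g dg h 0 (ltW h0).
  + move=> t; rewrite in_itv /= => /andP[t0 th]; apply: dgP.
    by rewrite !ler0_norm ?(ltW h0) ?(ltW th)// lerN2 ltW.
  + apply: continuous_in_subspaceT => t; rewrite inE /= in_itv /= => /andP[t0 th].
    by apply: cont; rewrite !ler0_norm ?(ltW h0)// lerN2.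
  rewrite in_itv /= => /andP[c0 ch] E; exists c.
    by rewrite !ler0_norm ?(ltW h0)// lerN2.
  by rewrite -opprB E; ring.
Qed.

Local Notation e_ i := (delta_mx 0 i).

Lemma norm_e (R : realType) (i : 'I_2) (c : R) :
  `|c *: (e_ i : 'rV[R]_2)| <= `|c|.
Proof.
rewrite normrZ ler_piMr//.
rewrite [leLHS]/Num.norm /= mx_normrE. apply: bigmax_le => // -[a b] _ /=.
by rewrite !mxE; case: (_ && _); rewrite ?normr1 ?normr0.
Qed.

Lemma partial_mean_value (R : realType) (g : 'rV[R]_2 -> R) (i : 'I_2)
    (y : 'rV[R]_2) (h : R) :
  (forall t, `|t| <= `|h| -> derivable g (y + t *: e_ i) (e_ i)) ->
  exists2 c, `|c| <= `|h| &
    g (y + h *: e_ i) - g y = h * partial i g (y + c *: e_ i).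
Proof.
move=> dg.
have [|c ch E] := @mean_value_signed R (fun t => g (y + t *: e_ i))
   (fun t => partial i g (y + t *: e_ i)) h.
  by move=> t th; apply: is_derive_line; apply/derivableP/dg.
by exists c => //; rewrite -E scale0r addr0.
Qed.

Lemma Ck_weaken (R : realType) k U (g : 'rV[R]_2 -> R) : Ck k.+1 U g -> Ck k U g.
Proof.
elim: k g => [|k IH] g [c d]; split=> // i.
by have [d1 d2] := d i; split => //; apply: IH.
Qed.

(** The derivative along v, as a combination of the partial derivatives rather
    than as a limit: bilinearity and the loss of one order of smoothness are
    then immediate, and [is_derive_dirder] recovers the limit. *)
Definition dirder {R : realType} (v : 'rV[R]_2) (g : 'rV[R]_2 -> R) :=
  fun x => v 0 0 * partial 0 g x + v 0 1 * partial 1 g x.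

Lemma rV2_decomp (R : realType) (v : 'rV[R]_2) :
  v = v 0 0 *: e_ 0 + v 0 1 *: e_ 1.
Proof.
rewrite [LHS]row_sum_delta big_ord_recl big_ord1.
by congr (_ *: _ + v 0 _ *: e_ _); apply/val_inj.
Qed.

Lemma open_box (R : realType) (U : set 'rV[R]_2) x : open U -> U x ->
  exists2 d, 0 < d & forall y, `|y| < d -> U (x + y).
Proof.
move=> oU Ux; have /nbhs_ballP[d d0 dU] : nbhs x U by exact: open_nbhs_nbhs.
exists d => // y yd; apply: dU; rewrite -ball_normE /=.
by rewrite opprD addrA subrr sub0r normrN.
Qed.

Lemma continuous_box (R : realType) (g : 'rV[R]_2 -> R) x e :
  {for x, continuous g} -> 0 < e ->
  exists2 d, 0 < d & forall y, `|y| < d -> `|g (x + y) - g x| < e.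
Proof.
move=> /cvgrPdist_lt/(_ _ _)/= c e0; have := c _ e0.
move=> /nbhs_ballP[d d0 dU]; exists d => // y yd; rewrite distrC; apply: dU.
by rewrite -ball_normE /= opprD addrA subrr sub0r normrN.
Qed.

(** Continuous partial derivatives give all directional derivatives: the
    increment along v is split into one step along each axis, and the mean
    value theorem is applied to each step. *)
Lemma is_derive_dirder (R : realType) (U : set 'rV[R]_2) (g : 'rV[R]_2 -> R)
    (x v : 'rV[R]_2) :
  open U -> Ck 1 U g -> U x -> is_derive x v g (dirder v g x).
Proof.
move=> oU [_ Cg] Ux.
have [d0g [c0 _]] := Cg 0; have [d1g [c1 _]] := Cg 1.
have H : (fun h : R => h^-1 *: (g (h *: v + x) - g x)) @ 0^' --> dirder v g x.
  apply/cvgrPdist_lt => /= e e_gt0.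
  pose S := `|v 0 0| + `|v 0 1| + 1.
  have S0 : 0 < S by rewrite /S ltr_wpDl ?addr_ge0.
  have [d d0 dU] := open_box oU Ux.
  have [da da0 ca] := continuous_box (c0 _ Ux) (divr_gt0 e_gt0 S0).
  have [db db0 cb] := continuous_box (c1 _ Ux) (divr_gt0 e_gt0 S0).
  pose m := Num.min d (Num.min da db).
  have m0 : 0 < m by rewrite /m !lt_min d0 da0.
  have mS : 0 < m / S by rewrite divr_gt0.
  near=> h.
  have h0 : h != 0 by near: h; exact: nbhs_dnbhs_neq.
  have hm : `|h| * S < m.
    rewrite -ltr_pdivlMr//; near: h; apply: dnbhs0_lt => //.
  have small a b : `|a| <= `|h * v 0 0| -> `|b| <= `|h * v 0 1| ->
      `|a *: (e_ 0 : 'rV[R]_2) + b *: e_ 1| < m.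
    move=> ha hb; apply: le_lt_trans hm.
    rewrite (le_trans (ler_normD _ _))// (le_trans (lerD (norm_e _ _) (norm_e _ _)))//.
    rewrite (le_trans (lerD ha hb))// !normrM -mulrDr ler_wpM2l// /S.
    by rewrite lerDl.
  have z0 (z : R) : `|0 : R| <= `|z| by rewrite normr0.
  have [|c hc Ec] := @partial_mean_value R g 0 x (h * v 0 0).
    move=> t ht; apply: d0g; apply: dU.
    have := small t 0 ht (z0 _); rewrite scale0r addr0 => /lt_le_trans; apply.
    by rewrite /m ge_min lexx.
  have [|c' hc' Ec'] := @partial_mean_value R g 1 (x + (h * v 0 0) *: e_ 0) (h * v 0 1).
    move=> t ht; apply: d1g; rewrite -addrA; apply: dU.
    have /lt_le_trans := small _ t (lexx _) ht; apply.
    by rewrite /m ge_min lexx.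
  have -> : h *: v + x = x + (h * v 0 0) *: e_ 0 + (h * v 0 1) *: e_ 1.
    by rewrite {1}(rV2_decomp v) scalerDr !scalerA addrC addrA.
  have -> : g (x + (h * v 0 0) *: e_ 0 + (h * v 0 1) *: e_ 1) - g x =
     h * v 0 0 * partial 0 g (x + c *: e_ 0) +
     h * v 0 1 * partial 1 g (x + (h * v 0 0) *: e_ 0 + c' *: e_ 1).
    by rewrite -Ec -Ec'; ring.
  rewrite /dirder /GRing.scale /=.
  set p0 := partial 0 g (x + _); set p1 := partial 1 g (x + _ + _).
  have hp0 : `|p0 - partial 0 g x| < e / S.
    apply: ca; have := small c 0 hc (z0 _); rewrite scale0r addr0 => /lt_le_trans; apply.
    by rewrite /m !ge_min lexx orbT.
  have hp1 : `|p1 - partial 1 g x| < e / S.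
    rewrite /p1 -addrA; apply: cb; have /lt_le_trans := small _ c' (lexx _) hc'; apply.
    by rewrite /m !ge_min lexx !orbT.
  move: (partial 0 g x) (partial 1 g x) p0 p1 hp0 hp1 => q0 q1 p0 p1 hp0 hp1.
  have -> : v 0 0 * q0 + v 0 1 * q1 - h^-1 * (h * v 0 0 * p0 + h * v 0 1 * p1) =
    - (v 0 0 * (p0 - q0) + v 0 1 * (p1 - q1)) by field.
  rewrite normrN; apply: (le_lt_trans (ler_normD _ _)); rewrite !normrM.
  apply: (@le_lt_trans _ _ ((`|v 0 0| + `|v 0 1|) * (e / S))).
    by rewrite mulrDl; apply: lerD; apply: ler_wpM2l => //; exact: ltW.
  rewrite mulrCA -ltr_pdivlMl// mulVf ?gt_eqF// ltr_pdivrMr// mul1r /S ltrDl//.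
split; first by apply/cvg_ex; eexists; exact: H.
by apply/cvg_lim => //; exact: H.
Unshelve. all: by end_near. Qed.

(** Both orders of differencing compute the same double difference, which is
    what makes mixed partial derivatives commute in [partialC]. *)
Lemma double_difference (R : realType) (U : set 'rV[R]_2) (g : 'rV[R]_2 -> R)
    (x : 'rV[R]_2) (i j : 'I_2) (d h : R) :
  Ck 2 U g -> (forall y, `|y| < d -> U (x + y)) -> `|h| + `|h| < d ->
  exists2 y, `|y| < d &
    g (x + h *: e_ i + h *: e_ j) - g (x + h *: e_ i)
    - (g (x + h *: e_ j) - g x) = h * h * partial j (partial i g) (x + y).
Proof.
move=> [_ Cg] dU hd.
have [dig [_ Cig]] := Cg i; have [djig _] := Cig j.
have small (a b : R) : `|a| <= `|h| -> `|b| <= `|h| ->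
    `|a *: (e_ i : 'rV[R]_2) + b *: e_ j| < d.
  move=> ha hb; apply: le_lt_trans hd.
  rewrite (le_trans (ler_normD _ _))// (le_trans (lerD (norm_e _ _) (norm_e _ _)))//.
  exact: lerD.
have inU (a b : R) : `|a| <= `|h| -> `|b| <= `|h| -> U (x + a *: e_ i + b *: e_ j).
  by move=> ha hb; rewrite -addrA; apply: dU; exact: small.
have h0 : `|0 : R| <= `|h| by rewrite normr0.
(* First the increment along e_ i of y |-> g (y + h *: e_ j) - g y, then the
   increment of partial i g along e_ j. *)
have [|c ch E] := @mean_value_signed R
   (fun t => g (x + h *: e_ j + t *: e_ i) - g (x + t *: e_ i))
   (fun t => partial i g (x + h *: e_ j + t *: e_ i) - partial i g (x + t *: e_ i)) h.
  move=> t th; apply: is_deriveB; apply: is_derive_line; apply/derivableP/dig.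
    by rewrite addrAC; exact: inU.
  by have := inU t 0 th h0; rewrite scale0r addr0.
have [|c' ch' E'] := @partial_mean_value R (partial i g) j (x + c *: e_ i) h.
  by move=> t th; apply: djig; exact: inU.
exists (c *: e_ i + c' *: e_ j); first exact: small.
rewrite addrA -mulrA -E'.
move: E; rewrite scale0r !addr0 [x + h *: e_ j + h *: e_ i]addrAC.
by rewrite [x + h *: e_ j + c *: e_ i]addrAC => <-.
Qed.

Lemma partialC (R : realType) (U : set 'rV[R]_2) (g : 'rV[R]_2 -> R) x i j :
  open U -> Ck 2 U g -> U x ->
  partial i (partial j g) x = partial j (partial i g) x.
Proof.
move=> oU Cg Ux.
have cont k l : {for x, continuous (partial k (partial l g))}.
  have [_ C1] := Cg; have [_ [_ C2]] := C1 l; have [_ [C3 _]] := C2 k.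
  exact: C3.
apply/eqP; rewrite -subr_eq0 -normr_le0; apply/ler_addgt0Pl => e e0; rewrite addr0.
have e20 : 0 < e / 2 by rewrite divr_gt0.
have [d d0 dU] := open_box oU Ux.
have [d1 d10 c1] := continuous_box (cont i j) e20.
have [d2 d20 c2] := continuous_box (cont j i) e20.
pose m := Num.min d (Num.min d1 d2).
have m0 : 0 < m by rewrite /m !lt_min d0 d10.
pose h := m / 4.
have h0 : 0 < h by rewrite divr_gt0.
have hm : `|h| + `|h| < m by rewrite gtr0_norm// /h; lra.
have mU y : `|y| < m -> U (x + y).
  by move=> ym; apply/dU/(lt_le_trans ym); rewrite /m ge_min lexx.
have [y ym Ey] := double_difference i j Cg mU hm.
have [z zm Ez] := double_difference j i Cg mU hm.
have Eyz : partial j (partial i g) (x + y) = partial i (partial j g) (x + z).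
  have hh : h * h != 0 by rewrite mulf_neq0 ?gt_eqF.
  have swapB (a b c c' : R) : a - b - (c - c') = a - c - (b - c') by ring.
  rewrite [x + h *: e_ j + h *: e_ i]addrAC in Ez.
  apply: (mulfI hh); exact: etrans (esym Ey) (etrans (swapB _ _ _ _) Ez).
have y2 : `|y| < d2 by apply: (lt_le_trans ym); rewrite /m !ge_min lexx !orbT.
have z1 : `|z| < d1 by apply: (lt_le_trans zm); rewrite /m !ge_min lexx !orbT.
have := c2 _ y2; have := c1 _ z1; rewrite -Eyz.
set A := partial i _ x; set B := partial j _ x; set D := partial j _ _.
clearbody A B D => hA hB.
have -> : A - B = (D - B) - (D - A) by ring.
by apply: (le_trans (ler_normB _ _)); rewrite (splitr e); apply: lerD; exact: ltW.
Qed.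

Lemma continuous_congr (R : realType) (U : set 'rV[R]_2) (f g : 'rV[R]_2 -> R) x :
  open U -> U x -> (forall x, U x -> f x = g x) ->
  {for x, continuous f} -> {for x, continuous g}.
Proof.
move=> oU Ux fg cf; have N : \forall y \near x, f y = g y.
  by apply: filterS fg _; exact: open_nbhs_nbhs.
suff : g @ x --> g x by [].
rewrite -fg//; apply: cvg_trans (cf : f @ x --> f x).
exact: (@near_eq_cvg _ _ (nbhs x) _ f g N).
Qed.

Lemma Ck_congr (R : realType) k (U : set 'rV[R]_2) (f g : 'rV[R]_2 -> R) :
  open U -> (forall x, U x -> f x = g x) -> Ck k U f -> Ck k U g.
Proof.
move=> oU; elim: k f g => [|k IH] f g fg [cf df].
  by split=> // x Ux; apply: (continuous_congr oU Ux fg); exact: cf.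
have N x : U x -> {near x, f =1 g}.
  by move=> Ux; apply: filterS fg _; exact: open_nbhs_nbhs.
split=> [x Ux|i]; first by apply: (continuous_congr oU Ux fg); exact: cf.
have [d1 d2] := df i; split=> [x Ux|].
  by apply: near_eq_derivable (N _ Ux) _; exact: d1.
apply: IH d2 => x Ux; rewrite /partial; apply: near_eq_derive => //; exact: N.
Qed.

Lemma is_partial_lin (R : realType) (f g : 'rV[R]_2 -> R) (a b : R) x i :
  derivable f x (e_ i) -> derivable g x (e_ i) ->
  is_derive x (e_ i) (fun x => a * f x + b * g x) (a * partial i f x + b * partial i g x).
Proof.
by move=> /derivableP df /derivableP dg; exact: (is_deriveD (is_deriveZ _ _) (is_deriveZ _ _)).
Qed.

Lemma Ck_lin (R : realType) k (U : set 'rV[R]_2) (f g : 'rV[R]_2 -> R) (a b : R) :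
  open U -> Ck k U f -> Ck k U g -> Ck k U (fun x => a * f x + b * g x).
Proof.
move=> oU; elim: k f g => [|k IH] f g [cf df] [cg dg]; split=> //.
- by move=> x Ux; exact: (cvgD (cvgM (cvg_cst a) (cf _ Ux)) (cvgM (cvg_cst b) (cg _ Ux))).
- by move=> x Ux; exact: (cvgD (cvgM (cvg_cst a) (cf _ Ux)) (cvgM (cvg_cst b) (cg _ Ux))).
move=> i; have [df1 df2] := df i; have [dg1 dg2] := dg i.
have D x : U x -> is_derive x (e_ i) (fun x => a * f x + b * g x)
     (a * partial i f x + b * partial i g x).
  by move=> Ux; apply: is_partial_lin; [exact: df1|exact: dg1].
split; first by move=> x /D[].
by apply: Ck_congr (IH _ _ df2 dg2) => // x /D[_]; rewrite /partial => ->.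
Qed.

Lemma Ck_dirder (R : realType) k (U : set 'rV[R]_2) (g : 'rV[R]_2 -> R) v :
  open U -> Ck k.+1 U g -> Ck k U (dirder v g).
Proof.
by move=> oU [_ dg]; apply: Ck_lin => //; [have [] := dg 0|have [] := dg 1].
Qed.

Lemma dirder_lin (R : realType) (U : set 'rV[R]_2) (f g : 'rV[R]_2 -> R) (a b : R) v x :
  open U -> Ck 1 U f -> Ck 1 U g -> U x ->
  dirder v (fun x => a * f x + b * g x) x = a * dirder v f x + b * dirder v g x.
Proof.
move=> oU [_ Cf] [_ Cg] Ux.
have D i : partial i (fun x => a * f x + b * g x) x
     = a * partial i f x + b * partial i g x.
  by have [_] := is_partial_lin a b ((Cf i).1 _ Ux) ((Cg i).1 _ Ux).
rewrite /dirder !D.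
by move: (partial 0 f x) (partial 1 f x) (partial 0 g x) (partial 1 g x) => *; ring.
Qed.

Lemma dirder_congr (R : realType) (U : set 'rV[R]_2) (f g : 'rV[R]_2 -> R) v x :
  open U -> U x -> (forall x, U x -> f x = g x) -> dirder v f x = dirder v g x.
Proof.
move=> oU Ux fg.
have N : {near x, f =1 g} by apply: filterS fg _; exact: open_nbhs_nbhs.
by rewrite /dirder /partial; congr (_ * _ + _ * _); apply: near_eq_derive.
Qed.

Lemma dirder2E (R : realType) (U : set 'rV[R]_2) (g : 'rV[R]_2 -> R) v w x :
  open U -> Ck 2 U g -> U x ->
  dirder v (dirder w g) x =
    v 0 0 * (w 0 0 * partial 0 (partial 0 g) x + w 0 1 * partial 0 (partial 1 g) x)
  + v 0 1 * (w 0 0 * partial 1 (partial 0 g) x + w 0 1 * partial 1 (partial 1 g) x).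
Proof.
move=> oU [_ Cg] Ux.
rewrite (dirder_lin _ _ _ oU (Cg 0).2 (Cg 1).2 Ux) /dirder.
generalize (partial 0 (partial 0 g) x) (partial 1 (partial 0 g) x).
by generalize (partial 0 (partial 1 g) x) (partial 1 (partial 1 g) x) => *; ring.
Qed.

Lemma dirderC (R : realType) (U : set 'rV[R]_2) (g : 'rV[R]_2 -> R) v w x :
  open U -> Ck 2 U g -> U x -> dirder v (dirder w g) x = dirder w (dirder v g) x.
Proof.
move=> oU Cg Ux; rewrite !(dirder2E _ _ oU Cg Ux).
have := partialC 1 0 oU Cg Ux.
generalize (partial 0 (partial 0 g) x) (partial 1 (partial 0 g) x).
by generalize (partial 0 (partial 1 g) x) (partial 1 (partial 1 g) x) => p q p' _ ->; ring.
Qed.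

(** One may commute inside the outer derivative because the two inner mixed
    derivatives agree on a whole neighbourhood. *)
Lemma dirder_third (R : realType) (U : set 'rV[R]_2) (u : 'rV[R]_2 -> R) v w x :
  open U -> Ck 3 U u -> U x ->
  dirder w (dirder w (dirder v u)) x = dirder v (dirder w (dirder w u)) x.
Proof.
move=> oU Cu Ux; transitivity (dirder w (dirder v (dirder w u)) x).
  apply: (dirder_congr _ oU Ux) => y Uy.
  exact: (dirderC _ _ oU (Ck_weaken Cu) Uy).
exact: (dirderC _ _ oU (Ck_dirder _ oU Cu) Ux).
Qed.

Lemma dirder_fourth (R : realType) (U : set 'rV[R]_2) (u : 'rV[R]_2 -> R) v w x :
  open U -> Ck 4 U u -> U x ->
  dirder w (dirder w (dirder v (dirder v u))) x = dirder v (dirder v (dirder w (dirder w u))) x.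
Proof.
move=> oU Cu Ux; rewrite (dirder_third _ _ oU (Ck_dirder _ oU Cu) Ux).
apply: (dirder_congr _ oU Ux) => y Uy.
exact: (dirder_third _ _ oU (Ck_weaken Cu) Uy).
Qed.

Lemma Ck_subset (R : realType) k (U V : set 'rV[R]_2) (g : 'rV[R]_2 -> R) :
  U `<=` V -> Ck k V g -> Ck k U g.
Proof.
move=> UV; elim: k g => [|k IH] g [cg dg]; split=> //.
- by move=> x /UV; exact: cg.
- by move=> x /UV; exact: cg.
- by move=> i; have [d1 d2] := dg i; split; [move=> x /UV; exact: d1|exact: IH].
Qed.

(** * Second-order conditions at an extremum on a line *)

Lemma is_derive_quotient_near (R : realType) (g : R -> R) (d e : R) :
  is_derive (0 : R) 1 g d -> 0 < e ->
  exists2 del : R, 0 < del &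
    forall h, `|h| < del -> h != 0 -> `|d - (g h - g 0) / h| < e.
Proof.
move=> [dg Dg] e0; have : (fun h : R => h^-1 *: (g (h *: 1 + 0) - g 0)) @ 0^' --> d.
  by rewrite -Dg; exact: dg.
move=> /cvgrPdist_lt/(_ _ e0) [del /= del0 H]; exists del => // h hd h0.
have := H h; rewrite /= sub0r normrN => /(_ hd h0).
by rewrite /GRing.scale /= mulr1 addr0 mulrC.
Qed.

Lemma is_derive_lower_bound (R : realType) (g : R -> R) (d c : R) :
  is_derive (0 : R) 1 g d -> (forall h, 0 < h -> h < 1 -> g 0 + h * c <= g h) -> c <= d.
Proof.
move=> dg H; apply/ler_addgt0Pr => e e0.
have [del del0 Hd] := is_derive_quotient_near dg e0.
have [h h0 [hd h1]] : exists2 h, 0 < h & h < del /\ h < 1.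
  exists (Num.min del 1 / 2); first by rewrite divr_gt0// lt_min del0 ltr01.
  have m1 : Num.min del 1 <= del by rewrite ge_min lexx.
  have m2 : Num.min del 1 <= 1 by rewrite ge_min lexx orbT.
  have m0 : 0 < Num.min del 1 by rewrite lt_min del0 ltr01.
  by split; lra.
have := Hd h; rewrite gtr0_norm// gt_eqF// => /(_ hd isT).
rewrite ltr_norml => /andP[+ _].
have : c <= (g h - g 0) / h by rewrite ler_pdivlMr// lerBrDl mulrC H.
lra.
Qed.

(** Were s negative, dphi would be negative just to the right of 0, and the
    mean value theorem would make phi decrease there. *)
Lemma second_derivative_test (R : realType) (phi dphi : R -> R) (s del : R) :
  0 < del -> (forall t : R, `|t| < del -> is_derive t 1 phi (dphi t)) ->
  is_derive (0 : R) 1 dphi s -> (forall t : R, `|t| < del -> phi 0 <= phi t) ->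
  dphi 0 = 0 /\ 0 <= s.
Proof.
move=> del0 dP ds pmin.
have d00 : dphi 0 = 0.
  have d0 := dP 0; rewrite normr0 in d0.
  have [_ <-] := d0 del0; apply: derive_val.
  apply: (@derive1_at_min _ phi (- del) del).
  - lra.
  - move=> t; rewrite in_itv /= => tt; apply: ex_derive; apply: dP.
    by rewrite ltr_norml.
  - by rewrite in_itv /=; lra.
  - by move=> t; rewrite in_itv /= => tt; apply: pmin; rewrite ltr_norml.
split=> //; rewrite leNgt; apply/negP => s0.
have e0 : 0 < - s by rewrite oppr_gt0.
have [eta eta0 Heta] := is_derive_quotient_near ds e0.
have [h h0 [hd he]] : exists2 h, 0 < h & h < del /\ h < eta.
  exists (Num.min del eta / 2); first by rewrite divr_gt0// lt_min del0.
  have m1 : Num.min del eta <= del by rewrite ge_min lexx.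
  have m2 : Num.min del eta <= eta by rewrite ge_min lexx orbT.
  have m0 : 0 < Num.min del eta by rewrite lt_min del0.
  by split; lra.
have dneg t : 0 < t -> t <= h -> dphi t < 0.
  move=> t0 th; have := Heta t; rewrite gtr0_norm// gt_eqF//.
  move=> /(_ (le_lt_trans th he) isT); rewrite d00 subr0 ltr_norml => /andP[+ _].
  move=> lt; have : dphi t / t < 0 by lra.
  by rewrite pmulr_llt0// invr_gt0.
have [||c] := @MVT R phi dphi 0 h h0.
- move=> t; rewrite in_itv /= => /andP[t0 th]; apply: dP.
  by rewrite gtr0_norm// (lt_trans th).
- apply: continuous_in_subspaceT => t; rewrite inE /= in_itv /= => /andP[t0 th].
  apply: differentiable_continuous; apply/derivable1_diffP; apply: ex_derive.
  by apply: dP; rewrite ger0_norm// (le_lt_trans th).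
rewrite in_itv /= => /andP[c0 ch] E.
have : phi 0 <= phi h by apply: pmin; rewrite gtr0_norm.
rewrite -subr_ge0 E subr0 => hh; have := dneg _ c0 (ltW ch).
by rewrite ltNge => /negP; apply; rewrite -(pmulr_lge0 _ h0).
Qed.

Lemma derD (R : realType) (f g : R -> R) (x df dg : R) : is_derive x 1 f df -> is_derive x 1 g dg ->
  is_derive x 1 (fun t => f t + g t) (df + dg).
Proof. by move=> ? ?; exact: is_deriveD. Qed.

Lemma derZ (R : realType) (a : R) (f : R -> R) (x df : R) :
  is_derive x 1 f df -> is_derive x 1 (fun t => a * f t) (a * df).
Proof. by move=> ?; exact: is_deriveZ. Qed.

Lemma derM (R : realType) (f g : R -> R) (x df dg : R) : is_derive x 1 f df -> is_derive x 1 g dg ->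
  is_derive x 1 (fun t => f t * g t) (f x * dg + g x * df).
Proof. by move=> ? ?; exact: is_deriveM. Qed.

Lemma der_expR (R : realType) (f : R -> R) (x df : R) : is_derive x 1 f df ->
  is_derive x 1 (fun t => expR (f t)) (expR (f x) * df).
Proof. by move=> ?; exact: is_derive1_comp. Qed.

Lemma der_parabola (R : realType) (s y x : R) :
  is_derive x 1 (fun t : R => s - 2 * t * y - t ^+ 2) (- 2 * y - 2 * x).
Proof.
have h : is_derive x 1 (fun t : R => t) 1 by exact: is_derive_id.
have hs : is_derive x 1 (fun=> s : R) 0 by exact: is_derive_cst.
have := derD hs (derD (derZ (- 2 * y) h) (derZ (-1) (derM h h))).
have -> : (fun t => s + (- 2 * y * t + -1 * (t * t))) =
   (fun t => s - 2 * t * y - t ^+ 2) by apply/funext => t; ring.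
by move=> D; apply: is_derive_eq; ring.
Qed.

(** The second-order conditions at a minimum of tr (F W) - K e^u on a line.
    In a frame where F = diag(a, b), and with p, q, P, S standing for u_1, u_2,
    u_11, u_22 along the line, W_11 = - P + (p^2 - q^2)/4 and
    W_22 = - S - (p^2 - q^2)/4. *)
Lemma supersolution_touching (R : realType) (P S p q z K P' S' p' q' z' K' : R -> R)
    (P2 S2 p2 q2 z2 K2 a b del : R) :
  0 < del ->
  (forall t : R, `|t| < del -> is_derive t 1 P (P' t)) ->
  (forall t : R, `|t| < del -> is_derive t 1 S (S' t)) ->
  (forall t : R, `|t| < del -> is_derive t 1 p (p' t)) ->
  (forall t : R, `|t| < del -> is_derive t 1 q (q' t)) ->
  (forall t : R, `|t| < del -> is_derive t 1 z (z' t)) ->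
  (forall t : R, `|t| < del -> is_derive t 1 K (K' t)) ->
  is_derive (0 : R) 1 P' P2 -> is_derive (0 : R) 1 S' S2 -> is_derive (0 : R) 1 p' p2 ->
  is_derive (0 : R) 1 q' q2 -> is_derive (0 : R) 1 z' z2 -> is_derive (0 : R) 1 K' K2 ->
  let h t := - a * P t - b * S t + (a - b) / 4 * (p t ^+ 2 - q t ^+ 2)
             - K t * expR (z t) in
  (forall t : R, `|t| < del -> h 0 <= h t) ->
  - a * P' 0 - b * S' 0 + (a - b) / 2 * (p 0 * p' 0 - q 0 * q' 0)
    - (K' 0 + K 0 * z' 0) * expR (z 0) = 0 /\
  0 <= - a * P2 - b * S2
    + (a - b) / 2 * (p' 0 ^+ 2 + p 0 * p2 - q' 0 ^+ 2 - q 0 * q2)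
    - (K2 + 2 * K' 0 * z' 0 + K 0 * z2 + K 0 * z' 0 ^+ 2) * expR (z 0).
Proof.
move=> d0 DP DS Dp Dq Dz DK DP' DS' Dp' Dq' Dz' DK' h hmin.
have n0 : `|0 : R| < del by rewrite normr0.
pose dh t := - a * P' t + - b * S' t + (a - b) / 2 * (p t * p' t + -1 * (q t * q' t))
    + -1 * ((K' t + K t * z' t) * expR (z t)).
have D1 (t : R) : `|t| < del -> is_derive t 1 h (dh t).
  move=> td.
  have := derD (derD (derD (derZ (- a) (DP _ td)) (derZ (- b) (DS _ td)))
     (derZ ((a - b) / 4) (derD (derM (Dp _ td) (Dp _ td))
        (derZ (-1) (derM (Dq _ td) (Dq _ td))))))
     (derZ (-1) (derM (DK _ td) (der_expR (Dz _ td)))).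
  set g := (fun _ => _); have -> : g = h by apply/funext => r; rewrite /g /h; ring.
  by move=> D; apply: is_derive_eq; rewrite /dh; field.
have D2 := derD (derD (derD (derZ (- a) DP') (derZ (- b) DS'))
     (derZ ((a - b) / 2) (derD (derM (Dp _ n0) Dp')
        (derZ (-1) (derM (Dq _ n0) Dq')))))
     (derZ (-1) (derM (derD DK' (derM (DK _ n0) Dz')) (der_expR (Dz _ n0)))).
have [e1 e2] := second_derivative_test d0 D1 D2 hmin.
split; first by apply: etrans _ e1; rewrite /dh; ring.
by apply: (le_trans e2); rewrite le_eqVlt; apply/orP; left; apply/eqP; field.
Qed.

(** The second-order conditions at a maximum of rho^2 Q on a line, cleared of
    denominators; sig - 2 t y - t^2 is the restriction of rho = s^2 - |x|^2 to
    a line of unit speed. *)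
Lemma cutoff_touching (R : realType) (Q Q' : R -> R) (Q2 sig y del : R) :
  0 < del -> 0 < sig ->
  (forall t : R, `|t| < del -> is_derive t 1 Q (Q' t)) -> is_derive (0 : R) 1 Q' Q2 ->
  (forall t : R, `|t| < del -> (sig - 2 * t * y - t ^+ 2) ^+ 2 * Q t <= sig ^+ 2 * Q 0) ->
  sig * Q' 0 = 4 * y * Q 0 /\ sig ^+ 2 * Q2 <= (24 * y ^+ 2 + 4 * sig) * Q 0.
Proof.
move=> d0 sig0 DQ DQ' Qmax.
have n0 : `|0 : R| < del by rewrite normr0.
have Dr t := der_parabola sig y t.
have Dr' : is_derive (0 : R) 1 (fun t : R => - 2 * y - 2 * t) (- 2).
  have h : is_derive (0 : R) 1 (fun t : R => t) 1 by exact: is_derive_id.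
  have hs : is_derive (0 : R) 1 (fun=> - 2 * y : R) 0 by exact: is_derive_cst.
  have := derD hs (derZ (- 2) h).
  set g := (fun _ => _); have -> : g = (fun t : R => - 2 * y - 2 * t).
    by apply/funext => r; rewrite /g; ring.
  by move=> D; apply: is_derive_eq; ring.
pose rho (t : R) := sig - 2 * t * y - t ^+ 2.
pose rho' (t : R) := - 2 * y - 2 * t.
pose G t := -1 * (rho t * rho t * Q t).
have D1 (t : R) : `|t| < del -> is_derive t 1 G
    (-1 * (rho t * rho t * Q' t + Q t * (rho t * rho' t + rho t * rho' t))).
  by move=> td; have := derZ (-1) (derM (derM (Dr t) (Dr t)) (DQ _ td)).
have D2 := derZ (-1) (derD (derM (derM (Dr 0) (Dr 0)) DQ')
  (derM (DQ _ n0) (derD (derM (Dr 0) Dr') (derM (Dr 0) Dr')))).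
have G0 : forall t, `|t| < del -> G 0 <= G t.
  move=> t td; rewrite /G !mulN1r lerN2 -!expr2; have := Qmax t td.
  by rewrite /rho expr0n /= mulr0 mul0r !subr0.
have [e1 e2] := second_derivative_test d0 D1 D2 G0.
have E : sig * Q' 0 = 4 * y * Q 0.
  apply: (mulfI (lt0r_neq0 sig0)); move: e1; rewrite /rho /rho'; lra.
split=> //; have := congr1 ( *%R y) E; move: e2; rewrite /rho /rho'.
lra.
Qed.

(** * The cone and the supporting functional of f *)

Lemma coord_le_norm (R : realType) (y : 'rV[R]_2) i : `|y 0 i| <= `|y|.
Proof.
rewrite [leRHS]/Num.norm /= mx_normrE; apply/bigmax_geP; right => /=.
by exists (0, i).
Qed.

Lemma open_Gamma (R : realType) (p : R) : 1 < p -> p <= 2 -> open (Gamma p).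
Proof.
move=> hp1 hp2.
suff op (l : 'rV[R]_2) : Gamma p l -> nbhs l (Gamma p) by rewrite openE => l /op.
case=> l1 l2.
have [d d0 [m1 m2]] : exists2 d : R, 0 < d &
    d * 2 <= l 0 1 - (p - 2) * l 0 0 /\ d * 2 <= l 0 0 - (p - 2) * l 0 1.
  exists (Num.min (l 0 1 - (p - 2) * l 0 0) (l 0 0 - (p - 2) * l 0 1) / 2).
    by rewrite divr_gt0// lt_min !subr_gt0 l1.
  by rewrite mulfVK// !ge_min !lexx orbT.
suff near (y : 'rV[R]_2) : `|l - y| < d -> Gamma p y.
  by apply/nbhs_ballP; exists d => //= y; rewrite -ball_normE /=; exact: near.
move=> ly; have c i : `|l 0 i - y 0 i| < d.
  by apply: le_lt_trans ly; have := coord_le_norm (l - y) i; rewrite !mxE.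
have := c 0; have := c 1; rewrite !ltr_norml => /andP[a1 a2] /andP[a3 a4].
have g1 : 0 <= (2 - p) * (l 0 0 - y 0 0 + d) by apply: mulr_ge0; lra.
have g2 : 0 <= (2 - p) * (d - (l 0 0 - y 0 0)) by apply: mulr_ge0; lra.
have g3 : 0 <= (2 - p) * (l 0 1 - y 0 1 + d) by apply: mulr_ge0; lra.
have g4 : 0 <= (2 - p) * (d - (l 0 1 - y 0 1)) by apply: mulr_ge0; lra.
have g5 : 0 < (p - 1) * d by apply: mulr_gt0; lra.
by split; lra.
Qed.

Lemma Gamma_conic (R : realType) (p a b : R) l m : 0 < a -> 0 <= b -> Gamma p l -> Gamma p m ->
  Gamma p (a *: l + b *: m).
Proof.
move=> a0 b0 [l1 l2] [m1 m2]; rewrite /Gamma /= !mxE.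
have e1 : 0 < a * (l 0 1 - (p - 2) * l 0 0) by rewrite mulr_gt0// subr_gt0.
have e2 : 0 < a * (l 0 0 - (p - 2) * l 0 1) by rewrite mulr_gt0// subr_gt0.
have e3 : 0 <= b * (m 0 1 - (p - 2) * m 0 0) by rewrite mulr_ge0// subr_ge0 ltW.
have e4 : 0 <= b * (m 0 0 - (p - 2) * m 0 1) by rewrite mulr_ge0// subr_ge0 ltW.
by split; lra.
Qed.

Lemma swap0 (R : realType) (l : 'rV[R]_2) : swap l 0 0 = l 0 1.
Proof. by rewrite mxE; congr (l 0 _); apply/val_inj. Qed.

Lemma swap1 (R : realType) (l : 'rV[R]_2) : swap l 0 1 = l 0 0.
Proof. by rewrite mxE; congr (l 0 _); apply/val_inj. Qed.

Lemma Gamma_swap (R : realType) (p : R) l : Gamma p l -> Gamma p (swap l).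
Proof. by case=> l1 l2; split; rewrite swap0 swap1. Qed.

(** The slope (3 - p)/(p - 1) is that of the boundary rays of the cone in the
    coordinates (trace, difference); it is finite exactly because p > 1. *)
Lemma Gamma_pinching (R : realType) (p : R) l : 1 < p -> p <= 2 -> Gamma p l ->
  0 < l 0 0 + l 0 1 /\ `|l 0 0 - l 0 1| <= (3 - p) / (p - 1) * (l 0 0 + l 0 1).
Proof.
move=> hp1 hp2 [l1 l2]; have p1 : 0 < p - 1 by rewrite subr_gt0.
split.
  have p3 : 0 < 3 - p by lra.
  by rewrite -(pmulr_rgt0 _ p3); lra.
rewrite mulrAC ler_pdivlMr// -{1}(gtr0_norm p1) -normrM ler_norml.
by apply/andP; split; lra.
Qed.

(** Concavity and homogeneity make f superadditive, so that
    f (l + h m) >= f l + h f m for h > 0; divide by h and let h tend to 0. *)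
Lemma support_vector (R : realType) (p : R) (f : 'rV[R]_2 -> R) (l m : 'rV[R]_2) :
  1 < p -> p <= 2 -> admissible (Gamma p) f -> Gamma p l -> Gamma p m ->
  f m <= m 0 0 * partial 0 f l + m 0 1 * partial 1 f l.
Proof.
move=> hp1 hp2 hf Gl Gm.
have Dl : is_derive (0 : R) 1 (fun h => f (l + h *: m)) (dirder m f l).
  apply: is_derive_line; rewrite scale0r addr0.
  by apply: is_derive_dirder Gl; [exact: open_Gamma|exact: adm_C1].
apply: (is_derive_lower_bound Dl) => h h0 _; rewrite scale0r addr0.
have h1 : 0 < 1 + h by rewrite addr_gt0.
have -> : l + h *: m = (1 + h) *: ((1 + h)^-1 *: l + (1 - (1 + h)^-1) *: m).
  by rewrite scalerDr !scalerA mulrBr mulr1 mulfV ?gt_eqF// scale1r addrAC subrr add0r.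
have i0 : 0 <= (1 + h)^-1 by rewrite invr_ge0 ltW.
have i1 : (1 + h)^-1 <= 1 by rewrite invf_le1//; lra.
rewrite (adm_homog hf)//; last first.
  by apply: subset_closure; apply: Gamma_conic => //; rewrite ?invr_gt0// subr_ge0.
rewrite -ler_pdivrMl//; apply: le_trans (adm_concave hf i0 i1 Gl Gm).
rewrite mulrDr lerD2l mulrA ler_wpM2r ?(ltW (adm_pos hf Gm))//.
by rewrite le_eqVlt; apply/orP; left; apply/eqP; field; rewrite gt_eqF.
Qed.

(** One inequality is [support_vector] at l itself; the other comes from
    moving in the direction - l. *)
Lemma euler_identity (R : realType) (p : R) (f : 'rV[R]_2 -> R) (l : 'rV[R]_2) :
  1 < p -> p <= 2 -> admissible (Gamma p) f -> Gamma p l ->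
  l 0 0 * partial 0 f l + l 0 1 * partial 1 f l = f l.
Proof.
move=> hp1 hp2 hf Gl; apply/eqP; rewrite eq_le; apply/andP; split; last first.
  exact: (support_vector hp1 hp2 hf Gl Gl).
have Dl : is_derive (0 : R) 1 (fun h => f (l + h *: (- l))) (dirder (- l) f l).
  apply: is_derive_line; rewrite scale0r addr0.
  by apply: is_derive_dirder Gl; [exact: open_Gamma|exact: adm_C1].
have : - f l <= dirder (- l) f l.
  apply: (is_derive_lower_bound Dl) => h h0 h1; rewrite scale0r addr0.
  have -> : l + h *: - l = (1 - h) *: l by rewrite scalerBl scale1r scalerN.
  rewrite (adm_homog hf) ?subr_gt0//; last exact: subset_closure.
  lra.
rewrite /dirder !mxE; generalize (partial 0 f l) (partial 1 f l) => ? ?; lra.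
Qed.

(** * Symmetric two by two matrices *)

Lemma eigenvalues_trace_det (R : realType) (A : 'M[R]_2) (l : 'rV[R]_2) :
  eigenvalues A l ->
  A 0 0 + A 1 1 = l 0 0 + l 0 1 /\ A 0 0 * A 1 1 - A 0 1 * A 1 0 = l 0 0 * l 0 1.
Proof.
rewrite /eigenvalues big_ord_recl big_ord1.
have -> : lift ord0 ord0 = 1 :> 'I_2 by apply/val_inj.
have -> : ord0 = 0 :> 'I_2 by apply/val_inj.
move=> E.
have tr : \tr A = A 0 0 + A 1 1.
  rewrite /mxtrace big_ord_recl big_ord1.
  by congr (A _ _ + A _ _); apply/val_inj.
have det : \det A = A 0 0 * A 1 1 - A 0 1 * A 1 0.
  rewrite (expand_det_row _ 0) big_ord_recl big_ord1 /cofactor !det_mx11 !mxE /=.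
  have -> : lift ord0 ord0 = 1 :> 'I_2 by apply/val_inj.
  have -> : ord0 = 0 :> 'I_2 by apply/val_inj.
  have -> : lift 1 0 = 0 :> 'I_2 by apply/val_inj.
  by rewrite /= addn0 add0n expr0 expr1 mul1r mulN1r mulrN.
have X : ('X - (l 0 0)%:P) * ('X - (l 0 1)%:P) =
    'X^2 - (l 0 0 + l 0 1) *: 'X + (l 0 0 * l 0 1)%:P :> {poly R}.
  rewrite -mul_polyC polyCD polyCM; ring.
have := char_poly_trace A isT; have := char_poly_det A.
rewrite E X tr det !coefE /= => e0 e1; split; lra.
Qed.

(** Off the diagonal case, (be, l0 - al) is an eigenvector for l0, by the
    characteristic equation; the second frame vector then takes care of itself
    because the matrix is symmetric with trace l0 + l1. *)
Lemma eigenframe (R : rcfType) (al be ga l0 l1 : R) :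
  al + ga = l0 + l1 -> al * ga - be ^+ 2 = l0 * l1 ->
  exists c s : R, [/\ c ^+ 2 + s ^+ 2 = 1,
    al * c ^+ 2 + 2 * be * c * s + ga * s ^+ 2 = l0,
    al * s ^+ 2 - 2 * be * c * s + ga * c ^+ 2 = l1 &
    (ga - al) * c * s + be * (c ^+ 2 - s ^+ 2) = 0].
Proof.
move=> tr det.
have [b0|b0] := eqVneq be 0.
  have /eqP : (al - l0) * (al - l1) = 0.
    have -> : (al - l0) * (al - l1) = al * (al - (l0 + l1)) + l0 * l1 by ring.
    by rewrite -tr -det b0; ring.
  rewrite mulf_eq0 !subr_eq0 => /orP[]/eqP E.
  - by exists 1, 0; rewrite b0; split; [ring|rewrite -E; ring|lra|ring].
  - by exists 0, 1; rewrite b0; split; [ring|lra|rewrite -E; ring|ring].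
set d := l0 - al; set n := Num.sqrt (be ^+ 2 + d ^+ 2).
have n2 : n ^+ 2 = be ^+ 2 + d ^+ 2 by rewrite sqr_sqrtr// addr_ge0// sqr_ge0.
have n0 : n != 0.
  by rewrite -sqrf_eq0 n2 gt_eqF// ltr_wpDr ?sqr_ge0// exprn_even_gt0.
have key : be ^+ 2 = d * (l0 - ga).
  have -> : be ^+ 2 = al * ga - l0 * l1 by rewrite -det; ring.
  have -> : l1 = al + ga - l0 by rewrite tr; ring.
  by rewrite /d; ring.
have nE : n ^+ 2 = d * (l0 - ga) + d ^+ 2 by rewrite n2 key.
have n20 : n ^+ 2 != 0 by rewrite expf_neq0.
have l1E : l1 = al + ga - l0 by rewrite tr; ring.
have X0 : al * (be / n) ^+ 2 + 2 * be * (be / n) * (d / n) + ga * (d / n) ^+ 2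
     = l0.
  have -> : al * (be / n) ^+ 2 + 2 * be * (be / n) * (d / n) + ga * (d / n) ^+ 2 =
      ((al + 2 * d) * be ^+ 2 + ga * d ^+ 2) / n ^+ 2 by field.
  by apply: (canLR (mulfK n20)); rewrite nE key /d; ring.
have X1 : (be / n) ^+ 2 + (d / n) ^+ 2 = 1.
  by rewrite !expr_div_n -mulrDl -n2 divff.
exists (be / n), (d / n); split => //.
- rewrite l1E -X0.
  have -> : al * (d / n) ^+ 2 - 2 * be * (be / n) * (d / n) + ga * (be / n) ^+ 2
   = (al + ga) * ((be / n) ^+ 2 + (d / n) ^+ 2) - (al * (be / n) ^+ 2 +
       2 * be * (be / n) * (d / n) + ga * (d / n) ^+ 2) by ring.
  by rewrite X1 mulr1.
- have -> : (ga - al) * (be / n) * (d / n) + be * ((be / n) ^+ 2 - (d / n) ^+ 2) =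
    be * ((ga - al) * d + be ^+ 2 - d ^+ 2) / n ^+ 2 by field.
  by rewrite key /d; ring.
Qed.

(** The diagonal of a symmetric matrix in any orthonormal frame is a convex
    combination of its eigenvalues in the two orders, since the off-diagonal
    entry o gives (d1 - l0) (d1 - l1) = - o^2.  A linear form on it is
    therefore bounded below by its smaller value on the two orders. *)
Lemma schur_horn (R : realFieldType) (l0 l1 d1 d2 o a b F : R) :
  d1 + d2 = l0 + l1 -> d1 * d2 - o ^+ 2 = l0 * l1 ->
  F <= a * l0 + b * l1 -> F <= a * l1 + b * l0 -> F <= a * d1 + b * d2.
Proof.
move=> tr det F1 F2.
have d2E : d2 = l0 + l1 - d1 by rewrite -tr; ring.
have o0 : (d1 - l0) * (d1 - l1) <= 0.
  have -> : (d1 - l0) * (d1 - l1) = d1 * (d1 - (l0 + l1)) + l0 * l1 by ring.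
  by rewrite -tr -det; have := sqr_ge0 o; nra.
rewrite d2E; have [ab|ab] := leP a b.
- have [x|x] := leP l0 l1.
  + have : d1 <= l1 by nra.
    nra.
  + have : d1 <= l0 by nra.
    nra.
- have [x|x] := leP l0 l1.
  + have : l0 <= d1 by nra.
    nra.
  + have : l1 <= d1 by nra.
    nra.
Qed.

(** * Pointwise algebra of the Bernstein estimate *)

(** The inequality for L Q.  It is twice the sum of the two second-order
    conditions, corrected by - 2 u_1 and - 2 u_2 times the first-order ones;
    the weight 2 of H in Q is the only one for which the terms in
    (a - b) (u11^2 - u22^2) cancel.  Here w1, w2, w3 are u_1111, u_1122 and
    u_2222. *)
Lemma bernstein_identity (R : realFieldType) (a b u1 u2 u11 u12 u22 u111 u112 u122 u222
    w1 w2 w3 K K1 K2 K11 K22 E : R) :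
  - a * u111 - b * u122 + (a - b) / 2 * (u1 * u11 - u2 * u12) - (K1 + K * u1) * E = 0 ->
  - a * u112 - b * u222 + (a - b) / 2 * (u1 * u12 - u2 * u22) - (K2 + K * u2) * E = 0 ->
  0 <= - a * w1 - b * w2 + (a - b) / 2 * (u11 ^+ 2 + u1 * u111 - u12 ^+ 2 - u2 * u112)
       - (K11 + 2 * K1 * u1 + K * u11 + K * u1 ^+ 2) * E ->
  0 <= - a * w2 - b * w3 + (a - b) / 2 * (u12 ^+ 2 + u1 * u122 - u22 ^+ 2 - u2 * u222)
       - (K22 + 2 * K2 * u2 + K * u22 + K * u2 ^+ 2) * E ->
  let Q1 := - 2 * (u111 + u122) + 2 * (u1 * u11 + u2 * u12) in
  let Q2 := - 2 * (u112 + u222) + 2 * (u1 * u12 + u2 * u22) in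
  let Q11 := - 2 * (w1 + w2) + 2 * (u11 ^+ 2 + u1 * u111 + u12 ^+ 2 + u2 * u112) in
  let Q22 := - 2 * (w2 + w3) + 2 * (u12 ^+ 2 + u1 * u122 + u22 ^+ 2 + u2 * u222) in
  (a + b) * (u11 ^+ 2 + 2 * u12 ^+ 2 + u22 ^+ 2)
    + 2 * E * (K11 + K22 + K1 * u1 + K2 * u2 + K * (u11 + u22))
  <= a * Q11 + b * Q22 - (a - b) / 2 * (u1 * Q1 - u2 * Q2).
Proof.
move=> h1 h2 H1 H2 /=.
have := congr1 ( *%R u1) h1; have := congr1 ( *%R u2) h2.
lra.
Qed.

(** Write d = (u1^2 - u2^2)/2, D = u11 - u22 and v = u1^2 + u2^2, so that
    v^2 = 4 d^2 + 4 (u1 u2)^2.  The off-diagonal condition puts u1 u2 inside M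
    and pinching bounds d - D by th H, so that v is controlled by M and,
    conversely, D by v and H. *)
Lemma hessian_dominates (R : realFieldType) (th u1 u2 u11 u12 u22 : R) :
  let H := - (u11 + u22) in
  0 <= H -> u12 = u1 * u2 / 2 ->
  `|(u1 ^+ 2 - u2 ^+ 2) / 2 - (u11 - u22)| <= th * H ->
  let M := u11 ^+ 2 + 2 * u12 ^+ 2 + u22 ^+ 2 in
  let Q := 2 * H + (u1 ^+ 2 + u2 ^+ 2) in
  Q ^+ 2 <= 48 * (1 + th ^+ 2) * M /\ M <= (1 + 2 * th ^+ 2) * Q ^+ 2.
Proof.
move=> H H0 u12E.
set d := (u1 ^+ 2 - u2 ^+ 2) / 2; set D := u11 - u22 => dD M Q.
set v := u1 ^+ 2 + u2 ^+ 2 in Q *; set P := u1 * u2.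
have vE : v ^+ 2 = 4 * d ^+ 2 + 4 * P ^+ 2 by rewrite /v /d /P; field.
have ME : M = (H ^+ 2 + D ^+ 2 + P ^+ 2) / 2 by rewrite /M u12E /H /D /P; field.
have v0 : 0 <= v by rewrite addr_ge0 ?sqr_ge0.
have dD2 : (d - D) ^+ 2 <= th ^+ 2 * H ^+ 2.
  rewrite -exprMn -[leLHS]real_normK ?num_real// ler_sqr// nnegrE ?normr_ge0//.
  exact: le_trans dD.
have hH := sqr_ge0 H; have hD := sqr_ge0 D; have hP := sqr_ge0 P.
have hd := sqr_ge0 d.
have ht : 0 <= th ^+ 2 := sqr_ge0 th.
have s1 : d ^+ 2 <= 2 * D ^+ 2 + 2 * (th ^+ 2 * H ^+ 2).
  by have := sqr_ge0 (d - 2 * D); nra.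
have s2 : D ^+ 2 <= 2 * d ^+ 2 + 2 * (th ^+ 2 * H ^+ 2).
  by have := sqr_ge0 (D - 2 * d); nra.
have hv : 0 <= H * v by apply: mulr_ge0.
have Q2 : Q ^+ 2 = 4 * H ^+ 2 + 4 * (H * v) + v ^+ 2 by rewrite /Q; ring.
split.
- have Q2' : Q ^+ 2 <= 8 * H ^+ 2 + 2 * v ^+ 2.
    by rewrite Q2; have := sqr_ge0 (2 * H - v); nra.
  apply: (le_trans Q2'); rewrite vE ME.
  have e1 : 0 <= th ^+ 2 * D ^+ 2 by rewrite mulr_ge0.
  have e2 : 0 <= th ^+ 2 * P ^+ 2 by rewrite mulr_ge0.
  have e3 : 0 <= th ^+ 2 * H ^+ 2 by rewrite mulr_ge0.
  by rewrite [leRHS](_ : _ = 24 * (H ^+ 2 + D ^+ 2 + P ^+ 2 + th ^+ 2 * H ^+ 2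
     + th ^+ 2 * D ^+ 2 + th ^+ 2 * P ^+ 2)); [lra|field].
- have e1 : 0 <= th ^+ 2 * v ^+ 2 by rewrite mulr_ge0 ?sqr_ge0.
  have e2 : 0 <= th ^+ 2 * (H * v) by rewrite mulr_ge0.
  have e3 : 0 <= th ^+ 2 * H ^+ 2 by rewrite mulr_ge0.
  rewrite ME Q2.
  rewrite [leRHS](_ : _ = 4 * H ^+ 2 + 4 * (H * v) + v ^+ 2 + 8 * (th ^+ 2 * H ^+ 2)
     + 8 * (th ^+ 2 * (H * v)) + 2 * (th ^+ 2 * v ^+ 2)); last ring.
  by lra.
Qed.

(** At a maximum of sig^2 Q the gradient and the second derivatives of Q are
    controlled by Q itself, and therefore so is L Q. *)
Lemma cutoff_combine (R : realFieldType) (a b u1 u2 y1 y2 sig X Q Q1 Q2 Q11 Q22 R1 R2 : R) :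
  0 <= a -> 0 <= b ->
  X <= a * Q11 + b * Q22 - (a - b) / 2 * (u1 * Q1 - u2 * Q2) ->
  sig * Q1 = 4 * y1 * Q -> sig * Q2 = 4 * y2 * Q ->
  sig ^+ 2 * Q11 <= R1 -> sig ^+ 2 * Q22 <= R2 ->
  sig ^+ 2 * X <= a * R1 + b * R2 - (a - b) / 2 * (sig * (4 * Q * (u1 * y1 - u2 * y2))).
Proof.
move=> a0 b0 hX h1 h2 h11 h22.
apply: le_trans (ler_wpM2l (sqr_ge0 sig) hX) _.
have -> : sig ^+ 2 * (a * Q11 + b * Q22 - (a - b) / 2 * (u1 * Q1 - u2 * Q2)) =
  a * (sig ^+ 2 * Q11) + b * (sig ^+ 2 * Q22)
  - (a - b) / 2 * (sig * (u1 * (sig * Q1) - u2 * (sig * Q2))) by field.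
rewrite h1 h2; apply: lerB; first by apply: lerD; rewrite ler_wpM2l.
by rewrite le_eqVlt; apply/orP; left; apply/eqP; field.
Qed.

Lemma quadratic_bound (R : realFieldType) (k x c1 c0 : R) :
  0 < k -> 0 <= c0 -> 0 <= c1 -> x ^+ 2 / (2 * k) <= c1 * x + c0 ->
  x <= 1 + 2 * k * (c1 + c0).
Proof.
move=> k0 c00 c10; rewrite ler_pdivrMr ?mulr_gt0// => h.
have p : 0 <= 2 * k * (c1 + c0) by rewrite !mulr_ge0 ?addr_ge0// ltW.
have [x1|x1] := leP x 1; first lra.
rewrite -(@ler_pM2l _ x) ?(lt_trans _ x1)//.
have : 0 <= (x - 1) * (2 * k * c0) by rewrite !mulr_ge0 ?subr_ge0 ?(ltW x1)// ltW.
nra.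
Qed.

(** With G = rho^2 Q, multiplying by a further rho^2 turns the differential
    inequality at the maximum into one that is quadratic in G.  The
    coefficient a + b multiplies every term except those coming from K, which
    are absorbed using a + b >= t; the drift, of order G^(3/2), is split by
    Young's inequality into half of the leading term and a linear one. *)
Lemma cutoff_bound (R : realFieldType) (k t s m N a b u1 u2 y1 y2 M H E rho K1 K2
    KL K : R) :
  let v := u1 ^+ 2 + u2 ^+ 2 in
  let Q := 2 * H + v in
  let B := 2 * m * N / t in
  0 < k -> 0 < t -> 0 < s -> 0 <= N -> 0 <= E -> E <= m ->
  0 <= a -> 0 <= b -> t <= a + b -> 0 <= H ->
  y1 ^+ 2 + y2 ^+ 2 <= s ^+ 2 -> 0 < rho -> rho <= s ^+ 2 ->
  Q ^+ 2 <= k * M ->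
  `|KL| <= 2 * N -> `|K1| <= N -> `|K2| <= N -> 0 <= K -> K <= N ->
  rho ^+ 2 * ((a + b) * M + 2 * E * (KL + K1 * u1 + K2 * u2 - K * H)) <=
    a * ((24 * y1 ^+ 2 + 4 * rho) * Q) + b * ((24 * y2 ^+ 2 + 4 * rho) * Q)
    - (a - b) / 2 * (rho * (4 * Q * (u1 * y1 - u2 * y2))) ->
  rho ^+ 2 * Q <= 1 + 2 * k * ((28 * s ^+ 2 + 2 * k * s ^+ 2 + 2 * B * s ^+ 4)
                              + 3 * B * s ^+ 8).
Proof.
move=> v Q B k0 t0 s0 N0 E0 Em a0 b0 tab H0 ys rho0 rhos QM KLN K1N K2N K0 KN main.
set T := a + b in tab main *.
have T0 : 0 < T := lt_le_trans t0 tab.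
have v0 : 0 <= v by rewrite addr_ge0 ?sqr_ge0.
have Q0 : 0 <= Q by rewrite addr_ge0 ?mulr_ge0.
have m0 : 0 <= m := le_trans E0 Em.
have B0 : 0 <= B by rewrite /B divr_ge0 ?mulr_ge0// ltW.
set G := rho ^+ 2 * Q.
have G0 : 0 <= G by rewrite mulr_ge0 ?sqr_ge0.
have s20 : 0 <= s ^+ 2 := sqr_ge0 s.
have k0' := ltW k0.
have s40 : 0 <= s ^+ 4 by rewrite exprn_ge0// ltW.
have s80 : 0 <= s ^+ 8 by rewrite exprn_ge0// ltW.
apply: quadratic_bound => //.
- by apply: mulr_ge0 => //; apply: mulr_ge0.
- apply: addr_ge0; last by apply: mulr_ge0 => //; apply: mulr_ge0.
  by apply: addr_ge0; apply: mulr_ge0 => //; apply: mulr_ge0.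
(* The curvature terms cost at most B (3 + 2 Q) after division by a + b. *)
have curv : - (T * B * (3 + 2 * Q)) <= 2 * E * (KL + K1 * u1 + K2 * u2 - K * H).
  have low : - (N * (3 + 2 * Q)) <= KL + K1 * u1 + K2 * u2 - K * H.
    have p (x z : R) : `|x| <= N -> - (N * (1 + z ^+ 2) / 2) <= x * z.
      move=> xN; have : `|x * z| <= N * ((1 + z ^+ 2) / 2).
        rewrite normrM; apply: ler_pM => //.
        have := sqr_ge0 (`|z| - 1); rewrite -(real_normK (num_real z)); lra.
      by rewrite ler_norml => /andP[]; lra.
    have := p _ u1 K1N; have := p _ u2 K2N.
    move: KLN; rewrite ler_norml => /andP[KL1 _].
    have : K * H <= N * Q.
      by apply: ler_pM => //; rewrite /Q; lra.
    have : 0 <= N * Q by rewrite mulr_ge0.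
    have : N * v <= N * Q by rewrite ler_wpM2l// /Q; lra.
    rewrite /v; lra.
  have NQ : 0 <= N * (3 + 2 * Q) by rewrite mulr_ge0//; lra.
  have e1 : 2 * E * - (N * (3 + 2 * Q)) <= 2 * E * (KL + K1 * u1 + K2 * u2 - K * H).
    by rewrite ler_wpM2l// mulr_ge0.
  apply: le_trans e1; rewrite mulrN lerN2.
  have e2 : 2 * E * (N * (3 + 2 * Q)) <= 2 * m * (N * (3 + 2 * Q)).
    by rewrite ler_wpM2r// ler_wpM2l.
  apply: (le_trans e2).
  have -> : 2 * m * (N * (3 + 2 * Q)) = t * (B * (3 + 2 * Q)).
    by rewrite /B; field; rewrite gt_eqF.
  rewrite -mulrA ler_wpM2r// mulr_ge0//; lra.
have QMk : T * (Q ^+ 2 / k) <= T * M.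
  by rewrite ler_wpM2l ?(ltW T0)// ler_pdivrMr// mulrC.
set z := u1 * y1 - u2 * y2 in main.
have z2 : z ^+ 2 <= s ^+ 2 * Q.
  apply: (@le_trans _ _ (s ^+ 2 * v)); last by rewrite ler_wpM2l// /Q; lra.
  apply: (@le_trans _ _ ((y1 ^+ 2 + y2 ^+ 2) * v)); last by rewrite ler_wpM2r.
  by rewrite /z /v; have := sqr_ge0 (u1 * y2 + u2 * y1); lra.
(* The weight is chosen so that the drift uses up half of G^2 / k. *)
have young : rho * `|z| <= G / (4 * k) + k * s ^+ 2.
  have s2p : 0 < s ^+ 2 by rewrite exprn_gt0.
  have ks : 0 < 4 * k * s ^+ 2 by rewrite !mulr_gt0.
  have h1 : (rho * `|z|) ^+ 2 <= s ^+ 2 * G.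
    rewrite exprMn real_normK ?num_real// /G [leRHS]mulrCA ler_wpM2l ?sqr_ge0//.
  have h2 : 0 <= (rho * `|z| - 2 * k * s ^+ 2) ^+ 2 := sqr_ge0 _.
  have h3 : 4 * k * s ^+ 2 * (rho * `|z|) <= s ^+ 2 * G + 4 * k ^+ 2 * s ^+ 4.
    by move: h2; rewrite sqrrB; nra.
  rewrite -(ler_pM2l ks); apply: (le_trans h3).
  by rewrite [leRHS](_ : _ = s ^+ 2 * G + 4 * k ^+ 2 * s ^+ 4)//; field; rewrite gt_eqF.
have drift : - (a - b) / 2 * (rho * (4 * Q * z)) <=
    T * (2 * Q * (G / (4 * k) + k * s ^+ 2)).
  apply: (le_trans (ler_norm _)).
  have -> : - (a - b) / 2 * (rho * (4 * Q * z)) = (b - a) * (2 * Q * (rho * z)) by field.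
  rewrite normrM; apply: ler_pM => //; first by rewrite ler_norml /T; apply/andP; split; lra.
  rewrite normrM [`|2 * Q|]ger0_norm ?mulr_ge0// ler_wpM2l ?mulr_ge0//.
  by rewrite normrM (ger0_norm (ltW rho0)).
have diag : a * ((24 * y1 ^+ 2 + 4 * rho) * Q) + b * ((24 * y2 ^+ 2 + 4 * rho) * Q)
    <= T * (28 * s ^+ 2 * Q).
  have q y : 0 <= y ^+ 2 -> y ^+ 2 <= s ^+ 2 -> (24 * y ^+ 2 + 4 * rho) * Q <= 28 * s ^+ 2 * Q.
    by move=> _ ?; rewrite ler_wpM2r//; lra.
  rewrite /T [leRHS]mulrDl; have := sqr_ge0 y1; have := sqr_ge0 y2 => ? ?.
  by rewrite lerD// ler_wpM2l// q//; lra.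
have tot : rho ^+ 2 * (T * (Q ^+ 2 / k) - T * B * (3 + 2 * Q)) <=
   T * (28 * s ^+ 2 * Q) + T * (2 * Q * (G / (4 * k) + k * s ^+ 2)).
  apply: (@le_trans _ _ (rho ^+ 2 * (T * M + 2 * E * (KL + K1 * u1 + K2 * u2 - K * H)))).
    by rewrite ler_wpM2l ?sqr_ge0//; lra.
  apply: (le_trans main); lra.
have tot' : rho ^+ 2 * (Q ^+ 2 / k - B * (3 + 2 * Q)) <=
   28 * s ^+ 2 * Q + 2 * Q * (G / (4 * k) + k * s ^+ 2).
  rewrite -(ler_pM2l T0); move: tot; lra.
have tot2 : rho ^+ 2 * (rho ^+ 2 * (Q ^+ 2 / k - B * (3 + 2 * Q))) <=
   rho ^+ 2 * (28 * s ^+ 2 * Q + 2 * Q * (G / (4 * k) + k * s ^+ 2)).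
  by rewrite ler_wpM2l ?sqr_ge0.
have L : rho ^+ 2 * (rho ^+ 2 * (Q ^+ 2 / k - B * (3 + 2 * Q))) =
   2 * (G ^+ 2 / (2 * k)) - 3 * (B * rho ^+ 4) - 2 * (B * rho ^+ 2 * G).
  by rewrite /G; field; rewrite gt_eqF.
have Rr : rho ^+ 2 * (28 * s ^+ 2 * Q + 2 * Q * (G / (4 * k) + k * s ^+ 2)) =
   28 * s ^+ 2 * G + G ^+ 2 / (2 * k) + 2 * k * s ^+ 2 * G.
  by rewrite /G; field; rewrite gt_eqF.
have r2 : rho ^+ 2 <= s ^+ 4.
  by rewrite (exprM s 2 2) ler_sqr ?nnegrE ?(ltW rho0).
have r4 : rho ^+ 4 <= s ^+ 8.
  by rewrite (exprM s 4 2) (exprM rho 2 2) ler_sqr ?nnegrE ?exprn_ge0 // ltW.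
have : B * rho ^+ 4 <= B * s ^+ 8 by rewrite ler_wpM2l.
have : B * rho ^+ 2 * G <= B * s ^+ 4 * G by rewrite ler_wpM2r// ler_wpM2l.
move: tot2; rewrite L Rr; lra.
Qed.

(** * Euclidean balls *)

Lemma enorm_rV (R : realType) (x : 'rV[R]_2) : enorm x ^+ 2 = x 0 0 ^+ 2 + x 0 1 ^+ 2.
Proof.
rewrite /enorm big_ord1 big_ord_recl big_ord1 sqr_sqrtr ?addr_ge0 ?sqr_ge0//.
by congr (x _ _ ^+ 2 + x _ _ ^+ 2); apply/val_inj.
Qed.

Lemma enorm_ge0 (R : realType) m n (A : 'M[R]_(m, n)) : 0 <= enorm A.
Proof. exact: sqrtr_ge0. Qed.

Lemma enorm_sq_continuous (R : realType) :
  continuous (fun x : 'rV[R]_2 => x 0 0 ^+ 2 + x 0 1 ^+ 2).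
Proof.
move=> x; have c i : (fun y : 'rV[R]_2 => y 0 i) @ x --> x 0 i by exact: coord_continuous.
rewrite /continuous_at !expr2.
exact: (cvgD (cvgM (c 0) (c 0)) (cvgM (c 1) (c 1))).
Qed.

Lemma enorm_ltE (R : realType) (x : 'rV[R]_2) (r : R) : 0 <= r ->
  (enorm x < r) = (x 0 0 ^+ 2 + x 0 1 ^+ 2 < r ^+ 2).
Proof. by move=> r0; rewrite -enorm_rV ltr_sqr ?nnegrE ?enorm_ge0. Qed.

Lemma enorm_leE (R : realType) (x : 'rV[R]_2) (r : R) : 0 <= r ->
  (enorm x <= r) = (x 0 0 ^+ 2 + x 0 1 ^+ 2 <= r ^+ 2).
Proof. by move=> r0; rewrite -enorm_rV ler_sqr ?nnegrE ?enorm_ge0. Qed.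

Lemma open_eball (R : realType) (r : R) : 0 < r -> open (eball r).
Proof.
move=> r0; have -> : eball r = (fun x : 'rV[R]_2 => x 0 0 ^+ 2 + x 0 1 ^+ 2) @^-1`
    [set y | y < r ^+ 2].
  by apply/seteqP; split => x /=; rewrite /eball /= enorm_ltE ?(ltW r0).
by apply: open_comp; [move=> x _; exact: enorm_sq_continuous|exact: open_lt].
Qed.

Lemma compact_closed_eball (R : realType) (s : R) : 0 <= s ->
  compact [set x : 'rV[R]_2 | enorm x <= s].
Proof.
move=> s0; apply: bounded_closed_compact.
  exists s; split; first exact: num_real.
  move=> M sM x /= xs; apply: le_trans (ltW sM).
  rewrite [leLHS]/Num.norm /= mx_normrE; apply: bigmax_le => // -[i j] _ /=.
  rewrite -(@ler_sqr _ `|_|) ?nnegrE// real_normK ?num_real//.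
  apply: (@le_trans _ _ (enorm x ^+ 2)); last by rewrite ler_sqr ?nnegrE ?enorm_ge0.
  rewrite enorm_rV (ord1 i); case: j => -[|[|//]] jl.
  - rewrite (_ : Ordinal jl = 0); last exact/val_inj.
    by rewrite lerDl sqr_ge0.
  - rewrite (_ : Ordinal jl = 1); last exact/val_inj.
    by rewrite lerDr sqr_ge0.
have -> : [set x : 'rV[R]_2 | enorm x <= s] =
    (fun x : 'rV[R]_2 => x 0 0 ^+ 2 + x 0 1 ^+ 2) @^-1` [set y | y <= s ^+ 2].
  by apply/seteqP; split => x /=; rewrite enorm_leE.
by apply: preimage_closed; [move=> x _; exact: enorm_sq_continuous|exact: closed_le].
Qed.

(** * Orthonormal frames *)

Definition vec2 {R : realType} (a b : R) : 'rV[R]_2 :=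
  \row_(j < 2) (if j == 0 then a else b).

Lemma vec20 (R : realType) (a b : R) : vec2 a b 0 0 = a.
Proof. by rewrite mxE. Qed.

Lemma vec21 (R : realType) (a b : R) : vec2 a b 0 1 = b.
Proof. by rewrite mxE. Qed.

Lemma frame_gradient (R : realType) (g : 'rV[R]_2 -> R) x (c s : R) :
  c ^+ 2 + s ^+ 2 = 1 ->
  dirder (vec2 c s) g x ^+ 2 + dirder (vec2 (- s) c) g x ^+ 2 =
  partial 0 g x ^+ 2 + partial 1 g x ^+ 2.
Proof.
move=> cs; rewrite /dirder !vec20 !vec21 -[RHS]mul1r -{1}cs.
by generalize (partial 0 g x) (partial 1 g x) => *; ring.
Qed.

Lemma frame_laplacian (R : realType) (U : set 'rV[R]_2) (g : 'rV[R]_2 -> R) x (c s : R) :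
  open U -> Ck 2 U g -> U x -> c ^+ 2 + s ^+ 2 = 1 ->
  let e := vec2 c s in let e' := vec2 (- s) c in
  dirder e (dirder e g) x + dirder e' (dirder e' g) x =
  partial 0 (partial 0 g) x + partial 1 (partial 1 g) x.
Proof.
move=> oU Cg Ux cs; rewrite /= !(dirder2E _ _ oU Cg Ux) !vec20 !vec21.
rewrite -[RHS]mul1r -{1}cs.
generalize (partial 0 (partial 0 g) x) (partial 0 (partial 1 g) x).
by generalize (partial 1 (partial 0 g) x) (partial 1 (partial 1 g) x) => *; ring.
Qed.

Lemma frame_hessian_norm (R : realType) (U : set 'rV[R]_2) (g : 'rV[R]_2 -> R) x (c s : R) :
  open U -> Ck 2 U g -> U x -> c ^+ 2 + s ^+ 2 = 1 ->
  let e := vec2 c s in let e' := vec2 (- s) c in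
  enorm (hessian g x) ^+ 2 =
  dirder e (dirder e g) x ^+ 2 + 2 * dirder e (dirder e' g) x ^+ 2 + dirder e' (dirder e' g) x ^+ 2.
Proof.
move=> oU Cg Ux cs; rewrite /= !(dirder2E _ _ oU Cg Ux) !vec20 !vec21.
have sym := partialC 1 0 oU Cg Ux.
have -> : enorm (hessian g x) ^+ 2 = (c ^+ 2 + s ^+ 2) ^+ 2 * (partial 0 (partial 0 g) x ^+ 2 +
   2 * partial 0 (partial 1 g) x ^+ 2 + partial 1 (partial 1 g) x ^+ 2).
  rewrite cs expr1n mul1r /enorm sqr_sqrtr; last first.
    by apply: sumr_ge0 => i _; apply: sumr_ge0 => j _; rewrite sqr_ge0.
  rewrite !(big_ord_recl, big_ord0) !mxE.
  have -> : lift ord0 ord0 = 1 :> 'I_2 by apply/val_inj.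
  have -> : ord0 = 0 :> 'I_2 by apply/val_inj.
  move: sym; generalize (partial 0 (partial 0 g) x) (partial 0 (partial 1 g) x).
  by generalize (partial 1 (partial 0 g) x) (partial 1 (partial 1 g) x) => p q r t ->; ring.
move: sym; generalize (partial 0 (partial 0 g) x) (partial 0 (partial 1 g) x).
by generalize (partial 1 (partial 0 g) x) (partial 1 (partial 1 g) x) => p q r t ->; ring.
Qed.

Lemma C2norm_bounds (R : realType) (U : set 'rV[R]_2) (K : 'rV[R]_2 -> R) (N : R) x :
  (C2norm U K <= N%:E)%E -> U x ->
  [/\ `|K x| <= N, enorm (gradient K x) <= N & enorm (hessian K x) <= N].
Proof.
move=> KN Ux.
have sup g : ((g x)%:E <= sup_on U g)%E.
  by apply: ereal_sup_ubound; exists x.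
have sup0 g : 0 <= g x -> (0 <= sup_on U g)%E.
  by move=> g0; apply: le_trans (sup g); rewrite lee_fin.
have a0 := sup0 (fun x => `|K x|) (normr_ge0 _).
have b0 := sup0 (fun x => enorm (gradient K x)) (enorm_ge0 _).
have c0 := sup0 (fun x => enorm (hessian K x)) (enorm_ge0 _).
split; rewrite -lee_fin; apply: le_trans KN; rewrite /C2norm.
- apply: le_trans (sup (fun x => `|K x|)) _.
  by rewrite -addeA leeDl// adde_ge0.
- apply: le_trans (sup (fun x => enorm (gradient K x))) _.
  by rewrite addeAC leeDr// adde_ge0.
- apply: le_trans (sup (fun x => enorm (hessian K x))) _.
  by rewrite leeDr// adde_ge0.
Qed.

Lemma frame_C2_bounds (R : realType) (U : set 'rV[R]_2) (K : 'rV[R]_2 -> R) (N : R) x (c s : R) :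
  open U -> Ck 2 U K -> U x -> c ^+ 2 + s ^+ 2 = 1 -> (C2norm U K <= N%:E)%E ->
  let e := vec2 c s in let e' := vec2 (- s) c in
  [/\ `|dirder e K x| <= N, `|dirder e' K x| <= N &
      `|dirder e (dirder e K) x + dirder e' (dirder e' K) x| <= 2 * N].
Proof.
move=> oU CK Ux cs /C2norm_bounds/(_ Ux)[_ gN hN] e e'.
have N0 : 0 <= N := le_trans (enorm_ge0 _) gN.
have sqN (a b : R) : a ^+ 2 <= b ^+ 2 -> 0 <= b -> `|a| <= b.
  by move=> ab b0; rewrite -ler_sqr ?nnegrE// real_normK ?num_real.
have g2 : dirder e K x ^+ 2 + dirder e' K x ^+ 2 <= N ^+ 2.
  apply: (@le_trans _ _ (enorm (gradient K x) ^+ 2)).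
    by rewrite enorm_rV !mxE frame_gradient.
  by rewrite ler_sqr ?nnegrE ?enorm_ge0.
have h2 : dirder e (dirder e K) x ^+ 2 + 2 * dirder e (dirder e' K) x ^+ 2
    + dirder e' (dirder e' K) x ^+ 2 <= N ^+ 2.
  by rewrite -(frame_hessian_norm oU CK Ux cs) ler_sqr ?nnegrE ?enorm_ge0.
have := sqr_ge0 (dirder e K x); have := sqr_ge0 (dirder e' K x) => a0 b0.
split; [by apply: sqN => //; lra|by apply: sqN => //; lra|].
have := sqr_ge0 (dirder e (dirder e K) x); have := sqr_ge0 (dirder e' (dirder e' K) x).
have := sqr_ge0 (dirder e (dirder e' K) x) => c0 d0 e0.
apply: le_trans (ler_normD _ _) _; rewrite mulrDl mul1r.
by apply: lerD; apply: sqN => //; lra.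
Qed.

(** These are polynomial identities in (c, s), valid for any multiple of an
    orthonormal frame: both u1^2 + u2^2 and the trace part of the conjugated
    matrix scale by c^2 + s^2. *)
Lemma Amx_frame (R : realType) (U : set 'rV[R]_2) (u : 'rV[R]_2 -> R) x (c s : R) :
  open U -> Ck 2 U u -> U x ->
  let e := vec2 c s in let e' := vec2 (- s) c in
  let A := Amx u x in let E := expR (u x) in
  let u1 := dirder e u x in let u2 := dirder e' u x in
  [/\ A 1 0 = A 0 1,
   E * (A 0 0 * c ^+ 2 + 2 * A 0 1 * c * s + A 1 1 * s ^+ 2) =
     - dirder e (dirder e u) x + (u1 ^+ 2 - u2 ^+ 2) / 4,
   E * (A 0 0 * s ^+ 2 - 2 * A 0 1 * c * s + A 1 1 * c ^+ 2) =
     - dirder e' (dirder e' u) x - (u1 ^+ 2 - u2 ^+ 2) / 4 &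
   E * ((A 1 1 - A 0 0) * c * s + A 0 1 * (c ^+ 2 - s ^+ 2)) =
     - dirder e (dirder e' u) x + u1 * u2 / 2].
Proof.
move=> oU Cu Ux e e' A E u1 u2.
have E0 : E != 0 by rewrite gt_eqF// expR_gt0.
have ent i j : A i j = E^-1 * (- partial j (partial i u) x
    + partial i u x * partial j u x / 2
    - (partial 0 u x ^+ 2 + partial 1 u x ^+ 2) / 4 * (i == j)%:R).
  rewrite /A /Amx !mxE big_ord1 enorm_rV !mxE -/E.
  generalize (partial j (partial i u) x) (partial i u x) (partial j u x).
  generalize (partial 0 u x) (partial 1 u x) => *.
  by case: (i == j); rewrite ?mulr1n ?mulr0n; field.
have sym := partialC 1 0 oU Cu Ux.
rewrite /u1 /u2 !(dirder2E _ _ oU Cu Ux) /dirder /e /e' !vec20 !vec21 !ent sym /=.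
generalize (partial 0 (partial 0 u) x) (partial 0 (partial 1 u) x).
generalize (partial 1 (partial 1 u) x) (partial 0 u x) (partial 1 u x).
by move=> h11 g0 g1 h00 h01; split; field.
Qed.

(** In this frame W is diagonal, which determines the mixed second derivative
    of u from its gradient. *)
Lemma eigenframe_at (R : realType) (U : set 'rV[R]_2) (u : 'rV[R]_2 -> R) x l :
  open U -> Ck 2 U u -> U x -> eigenvalues (Amx u x) l ->
  exists c s : R, c ^+ 2 + s ^+ 2 = 1 /\
    let e := vec2 c s in let e' := vec2 (- s) c in
    let u1 := dirder e u x in let u2 := dirder e' u x in
    [/\ - dirder e (dirder e u) x + (u1 ^+ 2 - u2 ^+ 2) / 4 = expR (u x) * l 0 0,
        - dirder e' (dirder e' u) x - (u1 ^+ 2 - u2 ^+ 2) / 4 = expR (u x) * l 0 1 &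
        dirder e (dirder e' u) x = u1 * u2 / 2].
Proof.
move=> oU Cu Ux /eigenvalues_trace_det[tr det].
have [sym _ _ _] := Amx_frame 0 0 oU Cu Ux.
rewrite sym -expr2 in det.
have [c [s [cs E0 E1 E2]]] := eigenframe tr det.
have [_ F0 F1 F2] := Amx_frame c s oU Cu Ux.
exists c, s; split=> //=; split; first by rewrite -F0 E0.
  by rewrite -F1 E1.
by move: F2; rewrite E2 mulr0 => /esym/eqP; rewrite addrC subr_eq0 => /eqP.
Qed.

(** The supporting functional bounds the value of f from above also in a frame that does not
    diagonalise the matrix, by [schur_horn]. *)
Lemma frame_support (R : realType) (U : set 'rV[R]_2) (u : 'rV[R]_2 -> R) x l
    (c s a b F : R) :
  open U -> Ck 2 U u -> U x -> eigenvalues (Amx u x) l -> c ^+ 2 + s ^+ 2 = 1 ->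
  F <= a * l 0 0 + b * l 0 1 -> F <= a * l 0 1 + b * l 0 0 ->
  let e := vec2 c s in let e' := vec2 (- s) c in
  let q := dirder e u x ^+ 2 - dirder e' u x ^+ 2 in
  F * expR (u x) <= a * (- dirder e (dirder e u) x + q / 4)
                    + b * (- dirder e' (dirder e' u) x - q / 4).
Proof.
move=> oU Cu Ux /eigenvalues_trace_det[tr det] cs F1 F2 /=.
have [sym D0 D1 _] := Amx_frame c s oU Cu Ux.
rewrite sym in det.
rewrite -D0 -D1 mulrC.
have -> (X Y E : R) : a * (E * X) + b * (E * Y) = E * (a * X + b * Y) by ring.
rewrite ler_wpM2l ?expR_ge0//.
move: (Amx u x 0 0) (Amx u x 0 1) (Amx u x 1 1) tr det => al be ga tr det.
apply: (@schur_horn _ (l 0 0) (l 0 1) _ _ ((ga - al) * c * s + be * (c ^+ 2 - s ^+ 2))) => //.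
  by rewrite -tr -[al + ga in RHS]mul1r -cs; ring.
rewrite -det.
have -> : al * ga - be * be = (c ^+ 2 + s ^+ 2) ^+ 2 * (al * ga - be * be).
  by rewrite cs expr1n mul1r.
by ring.
Qed.

(** The function Q, written in the standard frame; rotations leave it unchanged,
    by [bernstein_frame]. *)
Definition bernstein {R : realType} (u : 'rV[R]_2 -> R) (x : 'rV[R]_2) : R :=
  - 2 * (partial 0 (partial 0 u) x + partial 1 (partial 1 u) x)
  + (partial 0 u x ^+ 2 + partial 1 u x ^+ 2).

Lemma bernstein_frame (R : realType) (U : set 'rV[R]_2) (u : 'rV[R]_2 -> R) x (c s : R) :
  open U -> Ck 2 U u -> U x -> c ^+ 2 + s ^+ 2 = 1 ->
  let e := vec2 c s in let e' := vec2 (- s) c in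
  bernstein u x = - 2 * (dirder e (dirder e u) x + dirder e' (dirder e' u) x)
                  + (dirder e u x ^+ 2 + dirder e' u x ^+ 2).
Proof.
by move=> oU Cu Ux cs; rewrite /= (frame_laplacian oU Cu Ux cs) (frame_gradient _ _ cs).
Qed.

Lemma pinched_hessian (R : realType) (p : R) (U : set 'rV[R]_2) (u : 'rV[R]_2 -> R) x l
    (c s : R) :
  1 < p -> p <= 2 -> open U -> Ck 2 U u -> U x -> c ^+ 2 + s ^+ 2 = 1 -> Gamma p l ->
  let e := vec2 c s in let e' := vec2 (- s) c in
  let u1 := dirder e u x in let u2 := dirder e' u x in
  let u11 := dirder e (dirder e u) x in let u12 := dirder e (dirder e' u) x in
  let u22 := dirder e' (dirder e' u) x in
  let th := (3 - p) / (p - 1) in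
  let M := u11 ^+ 2 + 2 * u12 ^+ 2 + u22 ^+ 2 in
  - u11 + (u1 ^+ 2 - u2 ^+ 2) / 4 = expR (u x) * l 0 0 ->
  - u22 - (u1 ^+ 2 - u2 ^+ 2) / 4 = expR (u x) * l 0 1 ->
  u12 = u1 * u2 / 2 ->
  [/\ 0 < - (u11 + u22),
      bernstein u x ^+ 2 <= 48 * (1 + th ^+ 2) * M &
      M <= (1 + 2 * th ^+ 2) * bernstein u x ^+ 2].
Proof.
move=> hp1 hp2 oU Cu Ux cs Gl e e' u1 u2 u11 u12 u22 th M h0 h1 h2.
have [l0 lth] := Gamma_pinching hp1 hp2 Gl.
have E0 := expR_gt0 (u x).
have HE : - (u11 + u22) = expR (u x) * (l 0 0 + l 0 1).
  by rewrite mulrDr -h0 -h1; lra.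
have H0 : 0 < - (u11 + u22) by rewrite HE mulr_gt0.
have dD : `|(u1 ^+ 2 - u2 ^+ 2) / 2 - (u11 - u22)| <= th * - (u11 + u22).
  have -> : (u1 ^+ 2 - u2 ^+ 2) / 2 - (u11 - u22) = expR (u x) * (l 0 0 - l 0 1).
    by rewrite mulrBr -h0 -h1; lra.
  by rewrite HE normrM gtr0_norm// mulrCA ler_wpM2l// ltW.
have [q1 q2] := hessian_dominates (ltW H0) h2 dD.
have BE : bernstein u x = 2 * - (u11 + u22) + (u1 ^+ 2 + u2 ^+ 2).
  by rewrite (bernstein_frame oU Cu Ux cs) mulrN mulNr.
by rewrite BE.
Qed.

(** * The maximum principle *)

Lemma line_inside (R : realType) (U : set 'rV[R]_2) x (v : 'rV[R]_2) :
  open U -> U x ->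
  exists2 del : R, 0 < del & forall t : R, `|t| < del -> U (x + t *: v).
Proof.
move=> oU Ux; have [d d0 dU] := open_box oU Ux.
have v0 : 0 < `|v| + 1 by rewrite ltr_wpDl.
exists (d / (`|v| + 1)); first by rewrite divr_gt0.
move=> t; rewrite ltr_pdivlMr// => td; apply: dU; rewrite normrZ.
by apply: le_lt_trans td; rewrite ler_wpM2l// lerDl.
Qed.

Lemma line_derive (R : realType) (U : set 'rV[R]_2) (g : 'rV[R]_2 -> R) x
    (v : 'rV[R]_2) (t : R) :
  open U -> Ck 1 U g -> U (x + t *: v) ->
  is_derive t 1 (fun t => g (x + t *: v)) (dirder v g (x + t *: v)).
Proof. by move=> oU Cg Ux; apply: is_derive_line; exact: is_derive_dirder oU Cg Ux. Qed.

Lemma line_derive2 (R : realType) (U : set 'rV[R]_2) (g : 'rV[R]_2 -> R) x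
    (v : 'rV[R]_2) :
  open U -> Ck 2 U g -> U x ->
  is_derive (0 : R) 1 (fun t => dirder v g (x + t *: v)) (dirder v (dirder v g) x).
Proof.
move=> oU Cg Ux.
have := @line_derive R U (dirder v g) x v 0 oU (Ck_dirder _ oU Cg).
by rewrite scale0r addr0; apply.
Qed.

Lemma supersolution_dir (R : realType) (U : set 'rV[R]_2)
    (P S p q z K : 'rV[R]_2 -> R) (a b : R) (x v : 'rV[R]_2) :
  open U -> Ck 2 U P -> Ck 2 U S -> Ck 2 U p -> Ck 2 U q -> Ck 2 U z -> Ck 2 U K ->
  U x ->
  let h y := - a * P y - b * S y + (a - b) / 4 * (p y ^+ 2 - q y ^+ 2)
             - K y * expR (z y) in
  (forall y, U y -> h x <= h y) ->
  - a * dirder v P x - b * dirder v S x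
    + (a - b) / 2 * (p x * dirder v p x - q x * dirder v q x)
    - (dirder v K x + K x * dirder v z x) * expR (z x) = 0 /\
  0 <= - a * dirder v (dirder v P) x - b * dirder v (dirder v S) x
    + (a - b) / 2 * (dirder v p x ^+ 2 + p x * dirder v (dirder v p) x
                     - dirder v q x ^+ 2 - q x * dirder v (dirder v q) x)
    - (dirder v (dirder v K) x + 2 * dirder v K x * dirder v z x + K x * dirder v (dirder v z) x
       + K x * dirder v z x ^+ 2) * expR (z x).
Proof.
move=> oU CP CS Cp Cq Cz CK Ux h hmin.
have [del d0 dU] := line_inside v oU Ux.
have D1 g : Ck 2 U g -> forall t : R, `|t| < del ->
   is_derive t 1 (fun t => g (x + t *: v)) (dirder v g (x + t *: v)).
  by move=> Cg t td; apply: line_derive oU (Ck_weaken Cg) _; exact: dU.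
have := @supersolution_touching R _ _ _ _ _ _ _ _ _ _ _ _ _ _ _ _ _ _ a b del d0
  (D1 _ CP) (D1 _ CS) (D1 _ Cp) (D1 _ Cq) (D1 _ Cz) (D1 _ CK)
  (line_derive2 v oU CP Ux) (line_derive2 v oU CS Ux) (line_derive2 v oU Cp Ux)
  (line_derive2 v oU Cq Ux) (line_derive2 v oU Cz Ux) (line_derive2 v oU CK Ux).
rewrite /= scale0r addr0; apply => t td; exact: hmin (dU _ td).
Qed.

Lemma enorm_line (R : realType) (x v : 'rV[R]_2) (t : R) : enorm v = 1 ->
  enorm (x + t *: v) ^+ 2 =
  enorm x ^+ 2 + 2 * t * (x 0 0 * v 0 0 + x 0 1 * v 0 1) + t ^+ 2.
Proof.
move=> v1; have v2 : v 0 0 ^+ 2 + v 0 1 ^+ 2 = 1 by rewrite -enorm_rV v1 expr1n.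
have -> : t ^+ 2 = t ^+ 2 * (v 0 0 ^+ 2 + v 0 1 ^+ 2) by rewrite v2 mulr1.
by rewrite !enorm_rV !mxE; ring.
Qed.

Lemma cutoff_dir (R : realType) (U : set 'rV[R]_2)
    (P S p q : 'rV[R]_2 -> R) (x v : 'rV[R]_2) (s : R) :
  open U -> Ck 2 U P -> Ck 2 U S -> Ck 2 U p -> Ck 2 U q -> U x -> enorm v = 1 ->
  let sig := s ^+ 2 - enorm x ^+ 2 in
  let y := x 0 0 * v 0 0 + x 0 1 * v 0 1 in
  let Q z := - 2 * (P z + S z) + (p z ^+ 2 + q z ^+ 2) in
  let Q1 := - 2 * (dirder v P x + dirder v S x)
            + 2 * (p x * dirder v p x + q x * dirder v q x) in
  let Q2 := - 2 * (dirder v (dirder v P) x + dirder v (dirder v S) x)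
            + 2 * (dirder v p x ^+ 2 + p x * dirder v (dirder v p) x
                   + dirder v q x ^+ 2 + q x * dirder v (dirder v q) x) in
  0 < sig ->
  (forall z, U z -> (s ^+ 2 - enorm z ^+ 2) ^+ 2 * Q z <= sig ^+ 2 * Q x) ->
  sig * Q1 = 4 * y * Q x /\ sig ^+ 2 * Q2 <= (24 * y ^+ 2 + 4 * sig) * Q x.
Proof.
move=> oU CP CS Cp Cq Ux v1 sig y Q Q1 Q2 sig0 Qmax.
have [del d0 dU] := line_inside v oU Ux.
have n0 : `|0 : R| < del by rewrite normr0.
have D1 g : Ck 2 U g -> forall t : R, `|t| < del ->
   is_derive t 1 (fun t => g (x + t *: v)) (dirder v g (x + t *: v)).
  by move=> Cg t td; apply: line_derive oU (Ck_weaken Cg) _; exact: dU.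
have D2 g : Ck 2 U g -> is_derive (0 : R) 1 (fun t => dirder v g (x + t *: v))
    (dirder v (dirder v g) x) by move=> Cg; exact: line_derive2 oU Cg Ux.
pose L g (t : R) : R := g (x + t *: v).
have L0 g : L g 0 = g x by rewrite /L scale0r addr0.
pose Q' t := - 2 * (L (dirder v P) t + L (dirder v S) t)
            + 2 * (L p t * L (dirder v p) t + L q t * L (dirder v q) t).
have DQ (t : R) : `|t| < del -> is_derive t 1 (L Q) (Q' t).
  move=> td; have := derD (derZ (- 2) (derD (D1 _ CP _ td) (D1 _ CS _ td)))
    (derD (derM (D1 _ Cp _ td) (D1 _ Cp _ td)) (derM (D1 _ Cq _ td) (D1 _ Cq _ td))).
  move=> D; apply: is_derive_eq.
  rewrite /Q' /L; set w := x + t *: v.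
  generalize (p w) (q w) (dirder v P w) (dirder v S w) (dirder v p w) (dirder v q w).
  by move=> *; ring.
have DQ' : is_derive (0 : R) 1 Q' Q2.
  have := derD (derZ (- 2) (derD (D2 _ CP) (D2 _ CS)))
    (derZ 2 (derD (derM (D1 _ Cp _ n0) (D2 _ Cp)) (derM (D1 _ Cq _ n0) (D2 _ Cq)))).
  rewrite !scale0r !addr0 => D; apply: is_derive_eq; rewrite /Q2.
  generalize (p x) (q x) (dirder v p x) (dirder v q x) (dirder v (dirder v P) x).
  generalize (dirder v (dirder v S) x) (dirder v (dirder v p) x) (dirder v (dirder v q) x).
  by move=> *; ring.
have := @cutoff_touching R (L Q) Q' Q2 sig y del d0 sig0 DQ DQ'.
have -> : Q' 0 = Q1 by rewrite /Q' !L0.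
rewrite L0; apply => t td; rewrite /L.
apply: le_trans (Qmax _ (dU _ td)); rewrite le_eqVlt; apply/orP; left; apply/eqP.
by congr (_ ^+ 2 * _); rewrite enorm_line// /sig /y; ring.
Qed.

(** At an interior maximum of the cut-off times Q, choose an eigenframe of the
    equation at that point and the supporting functional of f there, and
    combine the four second-order conditions. *)
Lemma bernstein_cutoff_max (R : realType) (p : R) (f : 'rV[R]_2 -> R) (r s M N : R)
    (K u : 'rV[R]_2 -> R) (x : 'rV[R]_2) :
  1 < p -> p <= 2 -> admissible (Gamma p) f -> 0 < s -> s < r ->
  Ck 2 (eball r) K -> (forall x, eball r x -> 0 < K x) -> Ck 4 (eball r) u ->
  (forall x, eball r x -> u x <= M) -> (C2norm (eball r) K <= N%:E)%E ->
  (forall x, eball r x -> exists l : 'rV[R]_2,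
     [/\ eigenvalues (Amx u x) l, Gamma p l & f l = K x]) ->
  eball s x ->
  (forall z, eball s z -> (s ^+ 2 - enorm z ^+ 2) ^+ 2 * bernstein u z <=
     (s ^+ 2 - enorm x ^+ 2) ^+ 2 * bernstein u x) ->
  let k := 48 * (1 + ((3 - p) / (p - 1)) ^+ 2) in
  let B := 2 * expR M * N / f (vec2 1 1) in
  (s ^+ 2 - enorm x ^+ 2) ^+ 2 * bernstein u x <=
    1 + 2 * k * ((28 * s ^+ 2 + 2 * k * s ^+ 2 + 2 * B * s ^+ 4) + 3 * B * s ^+ 8).
Proof.
move=> hp1 hp2 hf s0 sr CK Kpos Cu uM KN eig sx Gmax /=.
have r0 : 0 < r := lt_trans s0 sr.
have oU := open_eball r0; have oS := open_eball s0.
have sub : eball s `<=` eball r by move=> z; rewrite /eball /= => /lt_trans; apply.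
have rx := sub _ sx.
have Cu2 : Ck 2 (eball r) u := Ck_weaken (Ck_weaken Cu).
have [l [El Gl fl]] := eig _ rx.
have [c [t [cs [h0 h1 h2]]]] := eigenframe_at oU Cu2 rx El.
set e := vec2 c t in h0 h1 h2; set e' := vec2 (- t) c in h0 h1 h2.
have e1 : enorm e = 1.
  by apply/eqP; rewrite -sqrp_eq1 ?enorm_ge0// enorm_rV vec20 vec21 cs.
have e'1 : enorm e' = 1.
  by apply/eqP; rewrite -sqrp_eq1 ?enorm_ge0// enorm_rV vec20 vec21 sqrrN addrC cs.
have [KN' _ _] := C2norm_bounds KN rx.
have Kx := Kpos _ rx.
have sig0 : 0 < s ^+ 2 - enorm x ^+ 2.
  by rewrite subr_gt0 ltr_sqr ?nnegrE ?enorm_ge0// ltW.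
have yE : (x 0 0 * e 0 0 + x 0 1 * e 0 1) ^+ 2 + (x 0 0 * e' 0 0 + x 0 1 * e' 0 1) ^+ 2
    <= s ^+ 2.
  rewrite /e /e' !vec20 !vec21.
  have -> : (x 0 0 * c + x 0 1 * t) ^+ 2 + (x 0 0 * - t + x 0 1 * c) ^+ 2 =
      (c ^+ 2 + t ^+ 2) * (x 0 0 ^+ 2 + x 0 1 ^+ 2) by ring.
  by rewrite cs mul1r -enorm_rV ltW// -subr_gt0.
have N0 : 0 <= N := le_trans (normr_ge0 _) KN'.
have KN0 : K x <= N by apply: le_trans (ler_norm _) KN'.
have Em : expR (u x) <= expR M by rewrite ler_expR uM.
have rho_le : s ^+ 2 - enorm x ^+ 2 <= s ^+ 2 by rewrite gerBl sqr_ge0.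
have k0 : 0 < 48 * (1 + ((3 - p) / (p - 1)) ^+ 2).
  by rewrite mulr_gt0// ltr_wpDr ?sqr_ge0.
have Cu1 : Ck 3 (eball r) (dirder e u) := Ck_dirder e oU Cu.
have Cu2' : Ck 3 (eball r) (dirder e' u) := Ck_dirder e' oU Cu.
have CP : Ck 2 (eball r) (dirder e (dirder e u)) := Ck_dirder e oU Cu1.
have CS : Ck 2 (eball r) (dirder e' (dirder e' u)) := Ck_dirder e' oU Cu2'.
have Cp := Ck_weaken Cu1; have Cq := Ck_weaken Cu2'.
have [a [b [a0 b0 supp euler]]] : exists a b : R, [/\ 0 < a, 0 < b,
    forall m, Gamma p m -> f m <= a * m 0 0 + b * m 0 1 &
    a * l 0 0 + b * l 0 1 = K x].
  exists (partial 0 f l), (partial 1 f l); split.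
  - exact: (adm_partial_pos hf Gl 0).
  - exact: (adm_partial_pos hf Gl 1).
  - by move=> m Gm; rewrite mulrC [X in _ + X]mulrC; exact: (support_vector hp1 hp2 hf Gl Gm).
  - by rewrite mulrC [X in _ + X]mulrC -fl; exact: (euler_identity hp1 hp2 hf Gl).
(* The point (1, 1) of the cone bounds the trace of F from below. *)
have G1 : Gamma p (vec2 1 1) by split; rewrite vec20 vec21 mulr1; lra.
have tab : f (vec2 1 1) <= a + b.
  by have := supp _ G1; rewrite vec20 vec21 !mulr1.
(* h is tr (F W) - K e^u, with F frozen at x but W varying. *)
pose h y := - a * dirder e (dirder e u) y - b * dirder e' (dirder e' u) y
   + (a - b) / 4 * (dirder e u y ^+ 2 - dirder e' u y ^+ 2) - K y * expR (u y).
have hx : h x = 0.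
  have -> : h x = a * (- dirder e (dirder e u) x + (dirder e u x ^+ 2 - dirder e' u x ^+ 2) / 4)
     + b * (- dirder e' (dirder e' u) x - (dirder e u x ^+ 2 - dirder e' u x ^+ 2) / 4)
     - K x * expR (u x).
    rewrite /h; generalize (dirder e (dirder e u) x) (dirder e' (dirder e' u) x) (dirder e u x).
    by generalize (dirder e' u x) => *; field.
  by rewrite h0 h1 -euler; ring.
have hmin y : eball r y -> h x <= h y.
  move=> ry; rewrite hx; have [m [Eigm Gm fm]] := eig _ ry.
  have s1 : K y <= a * m 0 0 + b * m 0 1 by rewrite -fm; exact: supp.
  have s2 : K y <= a * m 0 1 + b * m 0 0.
    rewrite -fm -(adm_sym hf); last exact: subset_closure.
    by have := supp _ (Gamma_swap Gm); rewrite swap0 swap1.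
  have := frame_support oU Cu2 ry Eigm cs s1 s2; rewrite /= -/e -/e' /h.
  generalize (dirder e (dirder e u) y) (dirder e' (dirder e' u) y) (dirder e u y).
  by generalize (dirder e' u y) (K y * expR (u y)) => *; lra.
have [m1 n1] := supersolution_dir e oU CP CS Cp Cq Cu2 CK rx hmin.
have [m2 n2] := supersolution_dir e' oU CP CS Cp Cq Cu2 CK rx hmin.
(* From here on all fourth-order derivatives are expressed through u_1111,
   u_1122 and u_2222, and all third-order ones through the derivatives of
   u_11 and u_22. *)
have t12 : dirder e (dirder e (dirder e' u)) x = dirder e' (dirder e (dirder e u)) x.
  exact: (dirder_third _ _ oU (Ck_weaken Cu) rx).
have t21 : dirder e' (dirder e' (dirder e u)) x = dirder e (dirder e' (dirder e' u)) x.
  exact: (dirder_third _ _ oU (Ck_weaken Cu) rx).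
have t22 : dirder e' (dirder e' (dirder e (dirder e u))) x =
    dirder e (dirder e (dirder e' (dirder e' u))) x.
  exact: (dirder_fourth _ _ oU Cu rx).
have d12 : dirder e' (dirder e u) x = dirder e (dirder e' u) x by exact: (dirderC _ _ oU Cu2 rx).
have QE z : eball s z -> bernstein u z =
    - 2 * (dirder e (dirder e u) z + dirder e' (dirder e' u) z)
   + (dirder e u z ^+ 2 + dirder e' u z ^+ 2).
  by move=> sz; exact: (bernstein_frame oU Cu2 (sub _ sz) cs).
have [H0 QM _] := pinched_hessian hp1 hp2 oU Cu2 rx cs Gl h0 h1 h2.
move: QE Gmax QM; generalize (bernstein u) as Q => Q QE Gmax QM.
have Gmax' z : eball s z -> (s ^+ 2 - enorm z ^+ 2) ^+ 2 *
    (- 2 * (dirder e (dirder e u) z + dirder e' (dirder e' u) z)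
     + (dirder e u z ^+ 2 + dirder e' u z ^+ 2))
    <= (s ^+ 2 - enorm x ^+ 2) ^+ 2 *
    (- 2 * (dirder e (dirder e u) x + dirder e' (dirder e' u) x)
     + (dirder e u x ^+ 2 + dirder e' u x ^+ 2)).
  by move=> sz; have := Gmax _ sz; rewrite (QE _ sz) (QE _ sx).
have S2 g : Ck 2 (eball r) g -> Ck 2 (eball s) g := @Ck_subset _ 2 _ _ g sub.
have [c1 d1] := cutoff_dir oS (S2 _ CP) (S2 _ CS) (S2 _ Cp) (S2 _ Cq) sx e1 sig0 Gmax'.
have [c2 d2] := cutoff_dir oS (S2 _ CP) (S2 _ CS) (S2 _ Cp) (S2 _ Cq) sx e'1 sig0 Gmax'.
have [K1 K2 KL] := frame_C2_bounds oU CK rx cs KN.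
have T0 := adm_pos hf G1; have E0 := expR_ge0 (u x).
rewrite (QE _ sx) in QM *.
move: t12 t21 t22 d12 m1 n1 m2 n2 c1 d1 c2 d2 QM H0 K1 K2 KL Kx KN0 Em E0 T0 tab.
move: yE sig0 rho_le k0; rewrite /e /e' /=.
(* What remains involves only the values at x; naming them reduces it to an
   inequality between real numbers. *)
generalize (vec2 c t) (vec2 (- t) c) => v w.
generalize (48 * (1 + ((3 - p) / (p - 1)) ^+ 2)) as k.
generalize (s ^+ 2 - enorm x ^+ 2) as rho.
generalize (x 0 0 * v 0 0 + x 0 1 * v 0 1) as y1.
generalize (x 0 0 * w 0 0 + x 0 1 * w 0 1) as y2.
generalize (f (vec2 1 1)) as T, (expR M) as m, (expR (u x)) as E, (K x) as Kx.
generalize (dirder v (dirder v K) x) as K11, (dirder w (dirder w K) x) as K22.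
generalize (dirder v K x) as K1, (dirder w K x) as K2.
generalize (dirder v (dirder v (dirder v (dirder v u))) x) as w1.
generalize (dirder v (dirder v (dirder w (dirder w u))) x) as w2.
generalize (dirder w (dirder w (dirder v (dirder v u))) x) as w2'.
generalize (dirder w (dirder w (dirder w (dirder w u))) x) as w3.
generalize (dirder v (dirder v (dirder w u)) x) as z12, (dirder w (dirder w (dirder v u)) x) as z21.
generalize (dirder v (dirder v (dirder v u)) x) as u111,
  (dirder w (dirder v (dirder v u)) x) as u112.
generalize (dirder v (dirder w (dirder w u)) x) as u122,
  (dirder w (dirder w (dirder w u)) x) as u222.
generalize (dirder v (dirder v u) x) as u11, (dirder v (dirder w u) x) as u12.
generalize (dirder w (dirder v u) x) as u21, (dirder w (dirder w u) x) as u22.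
generalize (dirder v u x) as u1, (dirder w u x) as u2.
move=> u1 u2 u21 u22 u11 u12 u122 u222 u111 u112 z12 z21 w3 w2' w2 w1.
move=> K1 K2 K11 K22 T m E Kx y2 y1 rho k yE rho0 rhos k0 -> -> -> ->.
move=> m1 n1 m2 n2 c1 d1 c2 d2 QM H0 K1N K2N KLN Kx0 KxN Em E0 T0 tab.
have main := bernstein_identity m1 m2 n1 n2.
have total := cutoff_combine (ltW a0) (ltW b0) main c1 c2 d1 d2.
have := @cutoff_bound R k T s m N a b u1 u2 y1 y2 (u11 ^+ 2 + 2 * u12 ^+ 2 + u22 ^+ 2)
  (- (u11 + u22)) E rho K1 K2 (K11 + K22) Kx.
have -> : 2 * - (u11 + u22) = - 2 * (u11 + u22) by ring.
rewrite /= mulrN opprK; apply => //; exact: ltW.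
Qed.

Lemma cutoff_bernstein_continuous (R : realType) (U : set 'rV[R]_2) (u : 'rV[R]_2 -> R)
    (s : R) x :
  Ck 2 U u -> U x ->
  {for x, continuous (fun z => (s ^+ 2 - enorm z ^+ 2) ^+ 2 * bernstein u z)}.
Proof.
move=> Cu Ux.
have [_ Cu1] := Cu.
have c1 i : {for x, continuous (partial i u)} by have [_ [ci _]] := Cu1 i; exact: ci.
have c2 i : {for x, continuous (partial i (partial i u))}.
  by have [_ [_ Ci]] := Cu1 i; have [_ [cii _]] := Ci i; exact: cii.
have cst (a : R) : {for x, continuous (fun _ : 'rV[R]_2 => a)} by exact: cst_continuous.
have cn : {for x, continuous (fun z : 'rV[R]_2 => enorm z ^+ 2)}.
  have -> : (fun z : 'rV[R]_2 => enorm z ^+ 2) = (fun z => z 0 0 ^+ 2 + z 0 1 ^+ 2).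
    by apply/funext => z; rewrite enorm_rV.
  exact: enorm_sq_continuous.
have cc := continuousB (cst (s ^+ 2)) cn.
have cL := continuousM (cst (- 2)) (continuousD (c2 0) (c2 1)).
have cG := continuousD (continuousM (c1 0) (c1 0)) (continuousM (c1 1) (c1 1)).
exact: (continuousM (continuousM cc cc) (continuousD cL cG)).
Qed.

(** The cut-off vanishes on the boundary of the ball while Q is positive, so
    the maximum over the closed ball is attained inside. *)
Lemma bernstein_interior_bound (R : realType) (p : R) (f : 'rV[R]_2 -> R) (r s M N : R)
    (K u : 'rV[R]_2 -> R) (y : 'rV[R]_2) :
  1 < p -> p <= 2 -> admissible (Gamma p) f -> 0 < s -> s < r ->
  Ck 2 (eball r) K -> (forall x, eball r x -> 0 < K x) -> Ck 4 (eball r) u ->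
  (forall x, eball r x -> u x <= M) -> (C2norm (eball r) K <= N%:E)%E ->
  (forall x, eball r x -> exists l : 'rV[R]_2,
     [/\ eigenvalues (Amx u x) l, Gamma p l & f l = K x]) ->
  eball s y ->
  let k := 48 * (1 + ((3 - p) / (p - 1)) ^+ 2) in
  let B := 2 * expR M * N / f (vec2 1 1) in
  (s ^+ 2 - enorm y ^+ 2) ^+ 2 * bernstein u y <=
    1 + 2 * k * ((28 * s ^+ 2 + 2 * k * s ^+ 2 + 2 * B * s ^+ 4) + 3 * B * s ^+ 8).
Proof.
move=> hp1 hp2 hf s0 sr CK Kpos Cu uM KN eig sy /=.
have r0 : 0 < r := lt_trans s0 sr.
have sub z : enorm z <= s -> eball r z by move=> zs; exact: le_lt_trans zs sr.
have Cu2 : Ck 2 (eball r) u := Ck_weaken (Ck_weaken Cu).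
pose G z := (s ^+ 2 - enorm z ^+ 2) ^+ 2 * bernstein u z.
have pos z : eball r z -> 0 < bernstein u z.
  move=> rz; have [l [El Gl _]] := eig _ rz.
  have [c [t [cs [h0 h1 h2]]]] := eigenframe_at (open_eball r0) Cu2 rz El.
  have [H0 _ _] := pinched_hessian hp1 hp2 (open_eball r0) Cu2 rz cs Gl h0 h1 h2.
  rewrite (bernstein_frame (open_eball r0) Cu2 rz cs) mulNr -mulrN.
  by rewrite ltr_wpDr ?addr_ge0 ?sqr_ge0// mulr_gt0.
have gap z : eball s z -> 0 < s ^+ 2 - enorm z ^+ 2.
  by move=> sz; rewrite subr_gt0 ltr_sqr ?nnegrE ?enorm_ge0// ltW.
have ys : enorm y <= s by exact: ltW.
have [x xs xmax] : exists2 x, enorm x <= s & forall z, enorm z <= s -> G z <= G x.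
  have [||x xs xmax] := @EVT_max_rV R 2 G _ _ (compact_closed_eball (ltW s0)).
  - by exists y.
  - apply: continuous_in_subspaceT => z; rewrite inE /= => zs.
    exact: (cutoff_bernstein_continuous Cu2 (sub _ zs)).
  - by exists x; [move: xs; rewrite inE|move=> z zs; apply: xmax; rewrite inE].
have Gx0 : 0 < G x.
  apply: lt_le_trans (xmax _ ys).
  by apply: mulr_gt0; [rewrite exprn_gt0 ?gap|exact: pos (sub _ ys)].
have sx : eball s x.
  rewrite /eball /= lt_neqAle xs andbT; apply/eqP => E.
  by move: Gx0; rewrite /G E subrr expr0n mul0r ltxx.
apply: le_trans (xmax _ ys) _.
apply: (bernstein_cutoff_max hp1 hp2 hf s0 sr CK Kpos Cu uM KN eig sx).
by move=> z sz; apply: xmax; exact: ltW.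
Qed.

Theorem theorem1p13 (R : realType) (p : R) (hp1 : 1 < p) (hp2 : p <= 2)
    (f : 'rV[R]_2 -> R) (hf : admissible (Gamma p) f)
    (r : R) (hr : 0 < r) (M N : R) :
  exists C : R, forall K u : 'rV[R]_2 -> R,
    Ck 2 (eball r) K ->
    (forall x, eball r x -> 0 < K x) ->
    Ck 4 (eball r) u ->
    (sup_on (eball r) u <= M%:E)%E ->
    (C2norm (eball r) K <= N%:E)%E ->
    (forall x, eball r x -> exists l : 'rV[R]_2,
       [/\ eigenvalues (Amx u x) l, Gamma p l & f l = K x]) ->
    forall x, eball (r / 2) x -> enorm (hessian u x) <= C.
Proof.
(* Any radius between r / 2 and r would do; gap is s^2 - (r / 2)^2. *)
pose s := 3 / 4 * r; pose th := (3 - p) / (p - 1); pose k := 48 * (1 + th ^+ 2).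
pose B := 2 * expR M * N / f (vec2 1 1).
pose C0 := 1 + 2 * k * ((28 * s ^+ 2 + 2 * k * s ^+ 2 + 2 * B * s ^+ 4) + 3 * B * s ^+ 8).
pose gap := 5 / 16 * r ^+ 2.
exists ((1 + 2 * th ^+ 2) * (C0 / gap ^+ 2)) => K u CK Kpos Cu supu KN eig x xr.
have s0 : 0 < s by rewrite mulr_gt0.
have sr : s < r by rewrite /s; lra.
have gap0 : 0 < gap by rewrite mulr_gt0// exprn_gt0.
have oU := open_eball hr.
have Cu2 : Ck 2 (eball r) u := Ck_weaken (Ck_weaken Cu).
have uM z : eball r z -> u z <= M.
  move=> rz; rewrite -lee_fin; apply: le_trans supu.
  by apply: ereal_sup_ubound; exists z.
have xs : eball s x.
  by apply: (lt_trans (xr : enorm x < r / 2)); rewrite /s; lra.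
have rx : eball r x := lt_trans xs sr.
have Gle := bernstein_interior_bound hp1 hp2 hf s0 sr CK Kpos Cu uM KN eig xs.
have [l [El Gl _]] := eig _ rx.
have [c [t [cs [h0 h1 h2]]]] := eigenframe_at oU Cu2 rx El.
have [H0 _ QM] := pinched_hessian hp1 hp2 oU Cu2 rx cs Gl h0 h1 h2.
have Q0 : 0 <= bernstein u x.
  rewrite (bernstein_frame oU Cu2 rx cs) mulNr -mulrN.
  by rewrite addr_ge0 ?addr_ge0 ?sqr_ge0// mulr_ge0// ltW.
move: QM; rewrite -(frame_hessian_norm oU Cu2 rx cs) -/th.
move: Gle Q0; rewrite -/th -/k -/B -/C0.
generalize (bernstein u x) (enorm_ge0 (hessian u x)).
generalize (enorm (hessian u x)) => h Q h_ge0 Gle Q0 hQ.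
have gapx : gap <= s ^+ 2 - enorm x ^+ 2.
  have : enorm x ^+ 2 <= (r / 2) ^+ 2.
    by rewrite ler_sqr ?nnegrE ?enorm_ge0 ?divr_ge0 ?(ltW hr)// ltW.
  by rewrite /gap /s !exprMn; lra.
have QC : Q <= C0 / gap ^+ 2.
  rewrite ler_pdivlMr ?exprn_gt0// mulrC; apply: le_trans Gle.
  by rewrite ler_wpM2r// ler_sqr ?nnegrE ?(le_trans _ gapx) ?(ltW gap0).
have t1 : 1 <= 1 + 2 * th ^+ 2 by rewrite lerDl mulr_ge0 ?sqr_ge0.
have t0 : 0 <= 1 + 2 * th ^+ 2 := le_trans ler01 t1.
apply: le_trans (ler_wpM2l t0 QC).
rewrite -ler_sqr ?nnegrE ?mulr_ge0// exprMn; apply: (le_trans hQ).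
by rewrite ler_wpM2r ?sqr_ge0// expr2 ler_peMr.
Qed.
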